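(* Let $(G,h)$ be a connected non-abelian cyclic Riemannian Lie group. Then the scalar curvature of $(G,h)$ is negative. In particular, neither the sectional curvature nor the Ricci curvature of $(G,h)$ can be positive.
   Context: A cyclic Riemannian Lie group is a Lie group $G$ with a left-invariant Riemannian metric $h$ such that $h([X,Y],Z)+h([Y,Z],X)+h([Z,X],Y)=0$ for all left-invariant vector fields $X,Y,Z$. (The scalar curvature of a left-invariant metric is constant.) *)

(* Defs.v *)
From HB Require Import structures.
From mathcomp Require Import all_boot all_order all_algebra.
From mathcomp Require Import all_classical all_reals all_analysis.

Set Implicit Arguments.
Unset Strict Implicit.
Unset Printing Implicit Defensive.

Import Order.TTheory GRing.Theory Num.Theory.
Import numFieldNormedType.Exports.

Local Open Scope classical_set_scope.
Local Open Scope ring_scope.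

(* For U open: f is C^(k+1) on U when it is differentiable at every point of U
   and all its directional derivatives are C^k on U. *)
Fixpoint Ck_on (R : realType) (V W : normedModType R) (U : set V) (k : nat)
    (f : V -> W) : Prop :=
  match k with
  | 0 => forall x, U x -> {for x, continuous f}
  | j.+1 => (forall x, U x -> differentiable f x) /\
            (forall v : V, Ck_on U j ('D_v f))
  end.

Definition smooth_on (R : realType) (V W : normedModType R) (U : set V)
    (f : V -> W) : Prop :=
  forall k, Ck_on U k f.

Definition smooth_near (R : realType) (V W : normedModType R) (f : V -> W)
    (x : V) : Prop :=
  exists2 U : set V, open_nbhs x U & smooth_on U f.

(* Homeomorphism from the open set dom onto an open subset of R^n, with inverse
   pt; coord and pt are unconstrained outside dom and coord @` dom. *)
Record chart (R : realType) (n : nat) (T : topologicalType) := Chart {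
  dom : set T;
  coord : T -> 'rV[R]_n;
  pt : 'rV[R]_n -> T;
  open_dom : open dom;
  open_img : open (coord @` dom);
  coordK : forall p, dom p -> pt (coord p) = p;
  coord_continuous : forall p, dom p -> {for p, continuous coord};
  pt_continuous : forall x, (coord @` dom) x -> {for x, continuous pt} }.

(* The charts chart_at p, p : M, form the atlas.  The tangent space at p is
   identified with R^n through the chart chart_at p: a tangent vector at p is a
   row vector, namely its components in chart_at p. *)
HB.mixin Record Topological_isManifold (R : realType) (n : nat) M
    of Topological M := {
  chart_at : M -> chart R n M;
  mem_chart_at : forall p, dom (chart_at p) p;
  transition_smooth : forall p q,
    smooth_on (coord (chart_at q) @` (dom (chart_at p) `&` dom (chart_at q)))
              (coord (chart_at p) \o pt (chart_at q));
  manifold_hausdorff : hausdorff_space M;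
  manifold_second_countable : @second_countable M }.

#[short(type="manifoldType")]
HB.structure Definition Manifold (R : realType) (n : nat) :=
  {M of Topological_isManifold R n M & Topological M}.

(* Multiplication and inversion are smooth: they are continuous and smooth when
   read in the charts of the arguments and of the value. *)
HB.mixin Record Manifold_Group_isLie (R : realType) (n : nat) G
    of Manifold R n G & Group G := {
  mulg_continuous : continuous (fun ab : G * G => (ab.1 * ab.2)%g);
  mulg_smooth : forall a b : G,
    smooth_near
      (fun z : 'rV[R]_n * 'rV[R]_n =>
         coord (chart_at (a * b)%g)
               (pt (chart_at a) z.1 * pt (chart_at b) z.2)%g)
      (coord (chart_at a) a, coord (chart_at b) b);
  invg_continuous : continuous (fun a : G => (a^-1)%g);
  invg_smooth : forall a : G,
    smooth_near
      (fun x : 'rV[R]_n => coord (chart_at (a^-1)%g) (pt (chart_at a) x)^-1%g)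
      (coord (chart_at a) a) }.

#[short(type="lieGroupType")]
HB.structure Definition LieGroup (R : realType) (n : nat) :=
  {G of Manifold_Group_isLie R n G & Manifold R n G & Group G}.

Section Manifold.
Variables (R : realType) (n : nat) (M : manifoldType R n).
Local Notation E := 'rV[R]_n.
Implicit Types (p q : M) (X Y Z : M -> E) (f : M -> R) (u v w : E).

Definition chart_img p : set E := coord (chart_at p) @` dom (chart_at p).

Definition base_coord p : E := coord (chart_at p) p.

Definition smooth_fun f : Prop :=
  forall p, smooth_on (chart_img p) (f \o pt (chart_at p)).

(* The components, in the chart chart_at p, of the vector field X, whose value
   at q is given by its components in chart_at q. *)
Definition field_in_chart p X : E -> E := fun x =>
  let q := pt (chart_at p) x in
  'd (coord (chart_at p) \o pt (chart_at q)) (base_coord q) (X q).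

Definition smooth_field X : Prop :=
  forall p, smooth_on (chart_img p) (field_in_chart p X).

Definition field_deriv X f : M -> R := fun p =>
  'd (f \o pt (chart_at p)) (base_coord p) (X p).

(* In coordinates, [X, Y] = DY(X) - DX(Y). *)
Definition lie_bracket X Y : M -> E := fun p =>
  'd (field_in_chart p Y) (base_coord p) (X p)
  - 'd (field_in_chart p X) (base_coord p) (Y p).

Record riemannian_metric (h : M -> E -> E -> R) : Prop := {
  metric_linear : forall p (a : R) u v w,
    h p (a *: u + v) w = a * h p u w + h p v w;
  metric_sym : forall p u v, h p u v = h p v u;
  metric_pos : forall p u, u != 0 -> 0 < h p u u;
  metric_smooth : forall X Y, smooth_field X -> smooth_field Y ->
    smooth_fun (fun p => h p (X p) (Y p)) }.

(* Only the values of nabla on smooth vector fields are constrained. *)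
Record levi_civita (h : M -> E -> E -> R)
    (nabla : (M -> E) -> (M -> E) -> (M -> E)) : Prop := {
  nabla_smooth : forall X Y, smooth_field X -> smooth_field Y ->
    smooth_field (nabla X Y);
  nabla_linear : forall f X Y Z, smooth_fun f ->
    smooth_field X -> smooth_field Y -> smooth_field Z ->
    forall p, nabla (fun q => f q *: X q + Y q) Z p
              = f p *: nabla X Z p + nabla Y Z p;
  nabla_additive : forall X Y Z,
    smooth_field X -> smooth_field Y -> smooth_field Z ->
    forall p, nabla X (fun q => Y q + Z q) p = nabla X Y p + nabla X Z p;
  nabla_leibniz : forall f X Y, smooth_fun f ->
    smooth_field X -> smooth_field Y ->
    forall p, nabla X (fun q => f q *: Y q) p
              = field_deriv X f p *: Y p + f p *: nabla X Y p;
  nabla_torsion_free : forall X Y, smooth_field X -> smooth_field Y ->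
    forall p, nabla X Y p - nabla Y X p = lie_bracket X Y p;
  nabla_metric : forall X Y Z,
    smooth_field X -> smooth_field Y -> smooth_field Z ->
    forall p, field_deriv X (fun q => h q (Y q) (Z q)) p
              = h p (nabla X Y p) (Z p) + h p (Y p) (nabla X Z p) }.

Section Curvature.
Variables (h : M -> E -> E -> R) (nabla : (M -> E) -> (M -> E) -> (M -> E)).

Definition riemann_field X Y Z : M -> E := fun p =>
  nabla X (nabla Y Z) p - nabla Y (nabla X Z) p - nabla (lie_bracket X Y) Z p.

(* The value R_p(u, v)w of the curvature tensor: for the Levi-Civita connection
   it does not depend on the smooth fields extending u, v and w. *)
Definition riemann p u v w : E :=
  xget 0 [set z | exists X Y Z,
    [/\ smooth_field X, smooth_field Y & smooth_field Z] /\
    [/\ X p = u, Y p = v, Z p = w & riemann_field X Y Z p = z]].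

Definition sectional_curvature p u v : R :=
  h p (riemann p u v v) u / (h p u u * h p v v - h p u v ^+ 2).

Local Notation basis i := (delta_mx 0 i : E).

(* Ric_p(u, v) is the trace of w |-> R_p(w, u)v. *)
Definition ricci p u v : R := \sum_(i < n) riemann p (basis i) u v 0 i.

Definition gram p : 'M[R]_n := \matrix_(i, j) h p (basis i) (basis j).

Definition scalar_curvature p : R :=
  \sum_(i < n) \sum_(j < n) invmx (gram p) i j * ricci p (basis i) (basis j).

Definition positive_sectional_curvature : Prop :=
  forall p u v, row_free (col_mx u v) -> 0 < sectional_curvature p u v.

Definition positive_ricci_curvature : Prop :=
  forall p u, u != 0 -> 0 < ricci p u u.

End Curvature.
End Manifold.

Section LeftInvariance.
Variables (R : realType) (n : nat) (G : lieGroupType R n).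
Local Notation E := 'rV[R]_n.

Definition left_translation_diff (a p : G) : E -> E :=
  'd (fun x : E => coord (chart_at (a * p)%g) (a * pt (chart_at p) x)%g)
     (base_coord p).

Definition left_invariant_field (X : G -> E) : Prop :=
  smooth_field X /\
  forall a p : G, X (a * p)%g = left_translation_diff a p (X p).

Definition left_invariant_metric (h : G -> E -> E -> R) : Prop :=
  forall (a p : G) (u v : E),
    h (a * p)%g (left_translation_diff a p u) (left_translation_diff a p v)
    = h p u v.

Definition cyclic_metric (h : G -> E -> E -> R) : Prop :=
  forall X Y Z : G -> E,
    left_invariant_field X -> left_invariant_field Y ->
    left_invariant_field Z ->
    forall p : G,
      h p (lie_bracket X Y p) (Z p) + h p (lie_bracket Y Z p) (X p)
      + h p (lie_bracket Z X p) (Y p) = 0.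

End LeftInvariance.

(* Main.v *)
From HB Require Import structures.
From mathcomp Require Import all_boot all_order all_algebra.
From mathcomp Require Import all_classical all_reals all_analysis.
From mathcomp Require Import ring lra.
Require Import Defs.
Import Order.TTheory GRing.Theory Num.Theory.
Import numFieldNormedType.Exports.
Set Implicit Arguments.
Unset Strict Implicit.
Unset Printing Implicit Defensive.
Local Open Scope classical_set_scope.
Local Open Scope ring_scope.

(** Why the theorem holds.

    Take a left-invariant orthonormal frame E_i and put
    c i j k = h([E_i, E_j], E_k), which is constant on G.  For a cyclic metric
    the three brackets in the Koszul formula combine into one, so that
    h(nabla_(E_i) E_j, E_k) = c k j i (lemma christoffel).  The curvature of the
    frame is then quadratic in the c i j k (curvature_frame), and the cyclic
    identity collapses the trace (sum_structure_constants) to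

      scal = - sum_k (sum_i c k i i)^2 - 1/2 sum_(i,j,k) (c i j k)^2

    (scalar_curvature_structure).  Hence scal <= 0, and scal = 0 forces all
    brackets of left-invariant fields to vanish; on a connected group this makes
    the group commutative (commutative_of_brackets0), which is excluded.  In an
    orthonormal frame scal is a sum of Ricci curvatures, and also a sum of
    sectional curvatures, so neither kind can be positive throughout.

    Tensoriality.  The curvature tensor is defined by extending tangent vectors
    to smooth fields.  Its value does not depend on the extensions because every
    smooth field is X = sum_i h(X, E_i) E_i with smooth coefficients: a global
    frame replaces the usual bump functions, and only linearity over smooth
    functions has to be checked (riemannE).  Linearity in the last argument is
    the identity [X, Y] f = X (Y f) - Y (X f), and the constancy of c i j k is
    the invariance of the bracket under left translations.  Both follow from one
    computation in a chart (diff_field_commutator), where the second-order terms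
    cancel by the symmetry of second derivatives (schwarz).

    Commutativity, without exponential map or flows.  Read x y = (x y x^-1) x
    in a chart at 1 and differentiate in y at 1: L(x) v = R(x) Ad_x v, where
    L(x) and R(x) are the partial differentials of the multiplication at (x, 1)
    and (1, x).  The derivative of L(x) v - R(x) v at x = 1 along u is the
    bracket [u, v], so if brackets vanish then R(x) (Ad_x v - v) = o(x - 1); as
    R(1) is the identity, Ad_x v has zero derivative at 1.  Since
    Ad_(a x) = Ad_a Ad_x it has zero derivative everywhere, hence Ad_a = id for
    all a, G being connected (Ad_trivial).  Now b |-> a b a^-1 b^-1 has zero
    derivative at 1, by translation it has zero derivative everywhere, and it is
    constant (commute_of_Ad_trivial). *)

(** * Differentials and C^k maps *)
Section Differential.
Variables (R : realType) (V W : normedModType R).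
Implicit Types (f g : V -> W) (x u v : V).

(** The epsilon form of differentiability: it identifies the differential at
    once and is stable under changing f away from x. *)
Lemma is_diff_of_estimate f (df : {linear V -> W}) x : continuous df ->
  (forall e, 0 < e -> \forall y \near x,
     `|f y - f x - df (y - x)| <= e * `|y - x|) -> is_diff x f df.
Proof.
move=> dfc fest.
have fE : f \o shift x = cst (f x) + df +o_ 0 id.
  apply/eqaddoP => e e0 /=; rewrite near_simpl.
  have := fest e e0.
  rewrite (near_shift 0 x) /=; apply: filterS => y.
  by rewrite /= subr0 addrK opprD addrA.
have dE := diff_unique dfc fE.
by split; [apply/diff_locallyP; rewrite dE|].
Qed.

Lemma differentiable_estimate f x : differentiable f x ->
  forall e, 0 < e -> \forall y \near x,
     `|f y - f x - 'd f x (y - x)| <= e * `|y - x|.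
Proof.
move=> /diff_locallyP[_ /eqaddoP fx] e e0.
have := fx e e0; rewrite near_simpl /= => fx0.
rewrite (near_shift 0 x) /=; apply: filterS fx0 => y /=.
by rewrite subr0 addrK opprD addrA.
Qed.

Lemma is_diffE f df x : is_diff x f df -> forall v, 'd f x v = df v.
Proof. by case=> _ ->. Qed.

Lemma near_eq_is_diff f g x df : (\near x, f x = g x) ->
  is_diff x f df -> is_diff x g df.
Proof.
move=> fg [dfx dfE].
have fgx : f x = g x by exact: nbhs_singleton fg.
rewrite -dfE; apply: is_diff_of_estimate; first exact: diff_continuous.
move=> e e0; have := differentiable_estimate dfx e0.
by apply: filterS2 fg => y; rewrite fgx => ->.
Qed.

Lemma near_eq_differentiable f g x : (\near x, f x = g x) ->
  differentiable f x -> differentiable g x.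
Proof. by move=> fg /differentiableP /(near_eq_is_diff fg) []. Qed.

Lemma near_eq_diff f g x : (\near x, f x = g x) ->
  differentiable f x -> 'd g x = 'd f x :> (V -> W).
Proof. by move=> fg /differentiableP /(near_eq_is_diff fg) []. Qed.

End Differential.

Section Ck.
Variable R : realType.
Implicit Types V W : normedModType R.

Lemma Ck_onW V W (U U' : set V) k (f : V -> W) :
  U' `<=` U -> Ck_on U k f -> Ck_on U' k f.
Proof.
move=> sU; elim: k f => [|k IH] f /=; first by move=> fc x /sU /fc.
by case=> fd fD; split=> [x /sU /fd //|v]; apply: IH.
Qed.

Lemma eq_Ck_on V W (U : set V) k (f g : V -> W) : open U ->
  (forall x, U x -> f x = g x) -> Ck_on U k f -> Ck_on U k g.
Proof.
move=> oU; elim: k f g => [|k IH] f g fg /=.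
  move=> fc x Ux; have fgx : {near x, f =1 g}.
    by apply: filterS (open_nbhs_nbhs (conj oU Ux)) => y /fg.
  have := fc x Ux; rewrite /prop_for /continuous_at (fg x Ux) => fcx.
  exact: cvg_trans (near_eq_cvg fgx) fcx.
have fgx x : U x -> {near x, f =1 g}.
  by move=> Ux; apply: filterS (open_nbhs_nbhs (conj oU Ux)) => y /fg.
case=> fd fD; split=> [x Ux|v].
  exact: near_eq_differentiable (fgx x Ux) (fd x Ux).
apply: (IH _ _ _ (fD v)) => x Ux; exact: near_eq_derive (fgx x Ux).
Qed.

Lemma Ck_on_local V W (U : set V) k (f : V -> W) :
  (forall x, U x -> exists2 U', open_nbhs x U' & Ck_on U' k f) -> Ck_on U k f.
Proof.
elim: k f => [|k IH] f fl /=.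
  by move=> x /fl[U' [_ U'x]]; apply.
split=> [x /fl[U' [_ U'x]] [fd _]|v]; first exact: fd.
by apply: IH => x /fl[U' oU' [_ fD]]; exists U' => //; exact: fD.
Qed.

Lemma Ck_onS V W (U : set V) k (f : V -> W) : Ck_on U k.+1 f -> Ck_on U k f.
Proof.
elim: k f => [|k IH] f; first by case=> fd _ x /fd; exact: differentiable_continuous.
by case=> fd fD; split=> // v; apply: IH; exact: fD.
Qed.

Lemma Ck_on_cst V W (U : set V) k (c : W) : Ck_on U k (cst c : V -> W).
Proof.
elim: k c => [|k IH] c /=; first by move=> x _; exact: cst_continuous.
split=> [x _|v]; first exact: differentiable_cst.
suff -> : 'D_v (cst c : V -> W) = cst 0 by exact: IH.
by apply/funext => x; rewrite derive_cst.
Qed.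

Lemma Ck_onD V W (U : set V) k (f g : V -> W) : open U ->
  Ck_on U k f -> Ck_on U k g -> Ck_on U k (fun x => f x + g x).
Proof.
move=> oU; elim: k f g => [|k IH] f g /=.
  by move=> fc gc x Ux; apply: continuousD; [exact: fc|exact: gc].
move=> [fd fD] [gd gD]; split=> [x Ux|v].
  by apply: differentiableD; [exact: fd|exact: gd].
apply: eq_Ck_on oU _ (IH _ _ (fD v) (gD v)) => x Ux /=.
by rewrite [RHS]deriveD //; apply: diff_derivable; [exact: fd|exact: gd].
Qed.

Lemma Ck_on_linear V W W' (U : set V) k (L : {linear W -> W'}) (f : V -> W) :
  open U -> continuous L -> Ck_on U k f -> Ck_on U k (L \o f).
Proof.
move=> oU Lc; elim: k f => [|k IH] f /=.
  by move=> fc x Ux; apply: continuous_comp; [exact: fc|exact: Lc].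
move=> [fd fD]; split=> [x Ux|v].
  by apply: differentiable_comp; [exact: fd|exact: linear_differentiable].
apply: eq_Ck_on oU _ (IH _ (fD v)) => x Ux /=.
have dL : differentiable L (f x) by exact: linear_differentiable.
rewrite !deriveE //; [|exact: differentiable_comp (fd x Ux) dL|exact: fd].
by rewrite (diff_comp (fd x Ux) dL) /= diff_lin.
Qed.

(** Used to restrict a smooth function of two variables to one of them. *)
Lemma Ck_on_affine V' V W (U : set V) (U' : set V') k (L : {linear V' -> V}) c
    (f : V -> W) : open U' -> continuous L ->
  (forall x, U' x -> U (c + L x)) -> Ck_on U k f ->
  Ck_on U' k (fun x => f (c + L x)).
Proof.
move=> oU' Lc sU; elim: k f => [|k IH] f /=.
  move=> fc x Ux; apply: (@continuous_comp _ _ _ (fun x => c + L x)) (fc _ (sU _ Ux)).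
  by apply: continuousD; [exact: cst_continuous|exact: Lc].
move=> [fd fD].
have dA x : is_diff x (fun x => c + L x) L.
  have dL : is_diff x L L.
    by split; [exact: linear_differentiable|exact: diff_lin].
  have [h1 h2] := is_diffD (is_diff_cst c x) dL.
  by split=> //; rewrite [LHS]h2; apply/funext => y; exact: add0r.
split=> [x Ux|v].
  apply: (@differentiable_comp _ _ _ _ (fun x => c + L x)) (fd _ (sU _ Ux)).
  by have [] := dA x.
apply: eq_Ck_on oU' _ (IH _ (fD (L v))) => x Ux /=.
have dAx : differentiable (fun x => c + L x) x by have [] := dA x.
have df := fd _ (sU _ Ux).
rewrite !deriveE //; last exact: differentiable_comp dAx df.
by rewrite (diff_comp dAx df) /=; have [_ ->] := dA x.
Qed.

Lemma scale_is_bilinear W : bilinear_for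
  (GRing.Scale.Law.clone _ _ *:%R _) (GRing.Scale.Law.clone _ _ *:%R _)
  (@GRing.scale R W).
Proof.
split=> [u'|u] a x y /=.
- by rewrite scalerDl scalerA.
- by rewrite scalerDr !scalerA mulrC.
Qed.

Lemma is_diff_scale V W (a da : V -> R) (f df : V -> W) x :
  is_diff x a da -> is_diff x f df ->
  is_diff x (fun y => a y *: f y) (fun v => a x *: df v + da v *: f x).
Proof.
move=> dax dfx.
pose bM := bilinear_isBilinear.Build R R W W _ _ (@GRing.scale R W)
  (scale_is_bilinear W).
pose b : {bilinear R -> W -> W} := HB.pack (@GRing.scale R W) bM.
have bc : continuous (fun p : R * W => b p.1 p.2).
  by move=> p; exact: scale_continuous.
have db : is_diff (a x, f x) (fun p : R * W => b p.1 p.2)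
    (fun q => a x *: q.2 + q.1 *: f x).
  by split; [exact: differentiable_bilin|rewrite diff_bilin].
exact: (is_diff_comp (is_diff_pair dax dfx) db).
Qed.

Lemma Ck_on_scale V W (U : set V) k (a : V -> R) (f : V -> W) : open U ->
  Ck_on U k a -> Ck_on U k f -> Ck_on U k (fun x => a x *: f x).
Proof.
move=> oU; elim: k a f => [|k IH] a f.
  by move=> ac fc x Ux; apply: continuousZ; [exact: ac|exact: fc].
move=> aS fS; have [ad aD] := aS; have [fd fD] := fS.
have dS x : U x -> is_diff x (fun y => a y *: f y)
    (fun v => a x *: 'd f x v + 'd a x v *: f x).
  by move=> Ux; apply: is_diff_scale; apply: differentiableP; [exact: ad|exact: fd].
split=> [x Ux|v]; first by have [] := dS x Ux.
have h1 := IH _ _ (Ck_onS aS) (fD v); have h2 := IH _ _ (aD v) (Ck_onS fS).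
apply: eq_Ck_on oU _ (Ck_onD oU h1 h2) => x Ux /=.
have [dx dE] := dS x Ux.
by rewrite (deriveE _ dx) dE !deriveE; [|exact: ad|exact: fd].
Qed.

Lemma Ck_on_sum V W (U : set V) k I (s : seq I) (f : I -> V -> W) : open U ->
  (forall i, Ck_on U k (f i)) -> Ck_on U k (fun x => \sum_(i <- s) f i x).
Proof.
move=> oU fC; elim: s => [|i s IH].
  by apply: eq_Ck_on oU _ (Ck_on_cst U k 0) => x _; rewrite big_nil.
by apply: eq_Ck_on oU _ (Ck_onD oU (fC i) IH) => x _; rewrite big_cons.
Qed.

(** An entry of a matrix as a function of the matrix, named so that it can
    carry a linear structure. *)
Definition mx_coord m n (i : 'I_m) (j : 'I_n) (M : 'M[R]_(m, n)) : R := M i j.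

Lemma mx_coord_is_linear m n i j : linear (@mx_coord m n i j).
Proof. by move=> a u v; rewrite /mx_coord !mxE. Qed.

HB.instance Definition _ m n i j := GRing.isLinear.Build R 'M[R]_(m, n) R _
  (@mx_coord m n i j) (@mx_coord_is_linear m n i j).

Lemma Ck_on_coord V m n (U : set V) k (f : V -> 'M[R]_(m, n)) i j : open U ->
  Ck_on U k f -> Ck_on U k (fun x => f x i j).
Proof.
move=> oU; apply: (@Ck_on_linear _ _ _ _ _ (@mx_coord m n i j)) => //.
move=> M; exact: (differentiable_continuous (@differentiable_coord R _ _ M i j)).
Qed.

Lemma linear_row_sum n W (L : {linear 'rV[R]_n -> W}) (v : 'rV[R]_n) :
  L v = \sum_(i < n) v 0 i *: L (delta_mx 0 i).
Proof.
by rewrite {1}[v]row_sum_delta linear_sum; apply: eq_bigr => i _; rewrite linearZ.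
Qed.

(** Since f takes values in row vectors, the chain rule reads 'D_v (g o f) =
    sum_i ('D_v f)_i *: ('D_(e_i) g o f), a sum of products of maps that are
    one order less smooth than f and g, so that induction on k applies. *)
Lemma Ck_on_comp V n W (U : set V) (U' : set 'rV[R]_n) k (f : V -> 'rV[R]_n)
    (g : 'rV[R]_n -> W) : open U ->
  (forall x, U x -> U' (f x)) ->
  Ck_on U k f -> Ck_on U' k g -> Ck_on U k (g \o f).
Proof.
move=> oU sU; elim: k f g sU => [|k IH] f g sU.
  by move=> fc gc x Ux; apply: continuous_comp; [exact: fc|exact/gc/sU].
move=> fS gS; have [fd fD] := fS; have [gd gD] := gS; split=> [x Ux|v].
  by apply: differentiable_comp; [exact: fd|exact/gd/sU].
have hi i := Ck_on_scale oU (Ck_on_coord 0 i oU (fD v))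
  (IH _ _ sU (Ck_onS fS) (gD (delta_mx 0 i))).
apply: eq_Ck_on oU _ (Ck_on_sum (index_enum 'I_n) oU hi) => x Ux /=.
have dfx := fd x Ux; have dgx := gd _ (sU x Ux).
rewrite (deriveE _ (differentiable_comp dfx dgx)) (diff_comp dfx dgx) /=.
rewrite linear_row_sum; apply: eq_bigr => i _.
by rewrite !deriveE.
Qed.

End Ck.

(** * Symmetry of second derivatives *)
Section Schwarz.
Variable R : realType.
Implicit Types V W : normedModType R.

Lemma is_diff_line V (x u : V) (s : R) :
  is_diff s (fun r : R => x + r *: u) (fun r => r *: u).
Proof.
have [h1 h2] := is_diffD (is_diff_cst x s) (is_diff_scalel s u).
by split=> //; rewrite [LHS]h2; apply/funext => y; exact: add0r.
Qed.

Lemma is_derive_line V W (f : V -> W) (x u : V) (s : R) :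
  differentiable f (x + s *: u) ->
  is_derive s 1 (fun r => f (x + r *: u)) ('D_u f (x + s *: u)).
Proof.
move=> df; have [dl lE] := is_diff_line x u s.
have dfl := differentiable_comp dl df.
split; first exact: (diff_derivable dfl).
rewrite (deriveE _ dfl) (diff_comp dl df) lE /= scale1r.
by rewrite deriveE.
Qed.

Lemma mean_value_line V (f : V -> R) (x u : V) (t : R) : 0 < t ->
  (forall s, 0 <= s <= t -> differentiable f (x + s *: u)) ->
  exists2 s, 0 <= s <= t & f (x + t *: u) - f x = t * 'D_u f (x + s *: u).
Proof.
move=> t0 fd; pose phi r := f (x + r *: u).
have dphi s : 0 <= s <= t -> is_derive s 1 phi ('D_u f (x + s *: u)).
  by move=> /fd; exact: is_derive_line.
have [|| s] := @MVT R phi (fun s => 'D_u f (x + s *: u)) 0 t t0.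
- by move=> s; rewrite in_itv /= => /andP[s0 st]; apply: dphi; rewrite !ltW.
- apply: derivable_within_continuous => s.
  by rewrite in_itv /= => /dphi[].
- rewrite in_itv /= => /andP[s0 st] E; exists s; first by rewrite !ltW.
  by move: E; rewrite /phi scale0r addr0 subr0 mulrC.
Qed.

Lemma derive_translate V W (f : V -> W) (w x u : V) :
  'D_u (fun y => f (y + w)) x = 'D_u f (x + w).
Proof. by rewrite /derive /=; under eq_fun do rewrite -addrA. Qed.

Lemma differentiable_translate V W (f : V -> W) (w x : V) :
  differentiable f (x + w) -> differentiable (fun y => f (y + w)) x.
Proof.
move=> df; apply: (@differentiable_comp _ _ _ _ (fun y => y + w)) df.
by apply: differentiableD => //; exact: differentiable_cst.
Qed.

(** The mean value theorem applied first along u to f(y + t v) - f(y), then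
    along v to 'D_u f. The left-hand side is symmetric in u and v: this is
    what makes second derivatives commute. *)
Lemma second_difference V (U : set V) (f : V -> R) (x u v : V) (t : R) : 0 < t ->
  (forall s r, 0 <= s <= t -> 0 <= r <= t -> U (x + s *: u + r *: v)) ->
  Ck_on U 2 f ->
  exists s r, [/\ 0 <= s <= t, 0 <= r <= t &
    f (x + t *: u + t *: v) - f (x + t *: u) - f (x + t *: v) + f x
    = t * (t * 'D_v ('D_u f) (x + s *: u + r *: v))].
Proof.
move=> t0 inU [fd fD].
have tt : 0 <= t <= t by rewrite lexx ltW.
have z0 : 0 <= (0 : R) <= t by rewrite lexx ltW.
have fd0 s : 0 <= s <= t -> differentiable f (x + s *: u).
  by move=> st; apply: fd; have := inU _ _ st z0; rewrite scale0r addr0.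
pose g y := f (y + t *: v) - f y.
have gd s : 0 <= s <= t -> differentiable g (x + s *: u).
  move=> st; apply: differentiableB; last exact: fd0.
  by apply: differentiable_translate; apply: fd; exact: inU.
have [s st gE] := mean_value_line t0 gd.
have Dd r : 0 <= r <= t -> differentiable ('D_u f) (x + s *: u + r *: v).
  by move=> rt; have [/(_ _ (inU _ _ st rt))] := fD u.
have [r rt rE] := mean_value_line t0 Dd.
exists s, r; split=> //; rewrite -rE.
have -> : 'D_u f (x + s *: u + t *: v) - 'D_u f (x + s *: u) = 'D_u g (x + s *: u).
  rewrite deriveB; first by rewrite derive_translate.
    apply: diff_derivable; apply: differentiable_translate; apply: fd; exact: inU.
  by apply: diff_derivable; exact: fd0.
by rewrite -gE /g opprB addrA addrAC.
Qed.

Lemma nbhs_parallelogram V (N : set V) (x u v : V) : nbhs x N ->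
  exists2 t : R, 0 < t &
    forall s r, 0 <= s <= t -> 0 <= r <= t -> N (x + s *: u + r *: v).
Proof.
move=> /nbhs_ballP[e /= e0 sN].
(* The points of the parallelogram are at distance at most t (|u| + |v|) from
   x; the summand 1 covers the case u = v = 0. *)
have d0 : 0 < 1 + `|u| + `|v| by rewrite -addrA ltr_wpDr // addr_ge0.
exists (e / (1 + `|u| + `|v|)) => [|s r /andP[s0 st] /andP[r0 rt]].
  exact: divr_gt0.
apply: sN; rewrite -ball_normE /= -addrA opprD addrA subrr sub0r normrN.
apply: (le_lt_trans (ler_normD _ _)); rewrite !normrZ !ger0_norm //.
apply: (@le_lt_trans _ _ (e / (1 + `|u| + `|v|) * (`|u| + `|v|))).
  by rewrite mulrDr lerD // ler_wpM2r.
rewrite mulrAC -mulrA gtr_pMr // ltr_pdivrMr // mul1r -addrA ltrDr //.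
Qed.

(** The second difference over a small parallelogram equals t^2 times a value
    of 'D_v 'D_u f and also t^2 times a value of 'D_u 'D_v f, at points that
    tend to x with t. *)
Lemma schwarz_scalar V (U : set V) (f : V -> R) (x u v : V) : open U -> U x ->
  Ck_on U 2 f -> 'D_u ('D_v f) x = 'D_v ('D_u f) x.
Proof.
move=> oU Ux f2; apply/eqP; rewrite -subr_eq0 -normr_le0.
apply/ler_addgt0Pr => e e0; rewrite add0r.
have near_D a b : \forall y \near x, `|'D_a ('D_b f) x - 'D_a ('D_b f) y| <= e / 2.
  have [_ /(_ b)[_ /(_ a)]] := f2 => /(_ x Ux) /cvgrPdist_le; apply.
  by rewrite divr_gt0.
have nN : nbhs x (U `&` [set y | `|'D_u ('D_v f) x - 'D_u ('D_v f) y| <= e / 2]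
    `&` [set y | `|'D_v ('D_u f) x - 'D_v ('D_u f) y| <= e / 2]).
  apply: filterI; last exact: near_D.
  by apply: filterI; [exact: open_nbhs_nbhs|exact: near_D].
have [t t0 inN] := nbhs_parallelogram u v nN.
have inU s r : 0 <= s <= t -> 0 <= r <= t -> U (x + s *: u + r *: v).
  by move=> st rt; have [[]] := inN _ _ st rt.
have inU' s r : 0 <= s <= t -> 0 <= r <= t -> U (x + s *: v + r *: u).
  by move=> st rt; rewrite addrAC; exact: inU.
have [s [r [st rt E1]]] := second_difference t0 inU f2.
have [s' [r' [st' rt' E2]]] := second_difference t0 inU' f2.
have E : 'D_v ('D_u f) (x + s *: u + r *: v) = 'D_u ('D_v f) (x + s' *: v + r' *: u).
  have tn : t != 0 by rewrite gt_eqF.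
  have tI a b : t * (t * a) = t * (t * b) -> a = b by move=> /(mulfI tn)/(mulfI tn).
  apply: tI; apply: etrans (esym E1) (etrans _ E2).
  by rewrite (addrAC x (t *: v)) (addrAC (f _)).
have [[_ /=]] := inN _ _ rt' st'; rewrite (addrAC x) -E => h1 _.
have [_ /=] := inN _ _ st rt => h2.
rewrite -(subrKA ('D_v ('D_u f) (x + s *: u + r *: v))).
rewrite [leRHS](splitr e); apply: (le_trans (ler_normD _ _)).
by apply: lerD; [exact: h1|rewrite distrC; exact: h2].
Qed.

Lemma derive_coord V m n (f : V -> 'M[R]_(m, n)) x u i j : differentiable f x ->
  'D_u (fun y => f y i j) x = 'D_u f x i j.
Proof. by move=> /(@diff_derivable _ _ _ _ _ u) df; rewrite derive_mx // mxE. Qed.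

Lemma schwarz V m n (U : set V) (f : V -> 'M[R]_(m, n)) (x u v : V) :
  open U -> U x -> Ck_on U 2 f -> 'D_u ('D_v f) x = 'D_v ('D_u f) x.
Proof.
move=> oU Ux f2; have [fd fD] := f2.
have E a b i j : 'D_a ('D_b f) x i j = 'D_a ('D_b (fun y => f y i j)) x.
  have [dD _] := fD b.
  rewrite -(derive_coord _ _ _ (dD x Ux)); apply: near_eq_derive.
  apply: filterS (open_nbhs_nbhs (conj oU Ux)) => y Uy.
  by rewrite (derive_coord _ _ _ (fd y Uy)).
apply/matrixP => i j; apply: etrans (E _ _ _ _) (etrans _ (esym (E _ _ _ _))).
exact: (schwarz_scalar u v oU Ux (Ck_on_coord i j oU f2)).
Qed.

End Schwarz.

(** * Differentiating along vector fields *)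
Section Pushforward.
Variables (R : realType) (W : normedModType R) (n : nat).
Local Notation E := 'rV[R]_n.
Local Notation e i := (delta_mx 0 i : E).
Implicit Types (U : set E) (f : E -> W) (X Y : E -> E).

Lemma is_diff_sum (V : normedModType R) (I : Type) (s : seq I) (f df : I -> V -> W) (x : V) :
  (forall i, is_diff x (f i) (df i)) ->
  is_diff x (fun y => \sum_(i <- s) f i y) (fun v => \sum_(i <- s) df i v).
Proof.
move=> fd; elim: s => [|i s IH].
  have [h1 h2] : is_diff x (cst 0 : V -> W) 0 by exact: is_diff_cst.
  split; first by under eq_fun do rewrite big_nil.
  by under eq_fun do rewrite big_nil; rewrite [LHS]h2; apply/funext => v; rewrite big_nil.
have [h1 h2] := is_diffD (fd i) IH.
split; first by under eq_fun do rewrite big_cons.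
by under eq_fun do rewrite big_cons; rewrite [LHS]h2; apply/funext => v; rewrite big_cons.
Qed.

Lemma diff_coordsE U f x u : U x -> Ck_on U 1 f ->
  'd f x u = \sum_(i < n) u 0 i *: 'D_(e i) f x.
Proof.
move=> Ux [/(_ x Ux) fd _]; rewrite linear_row_sum.
by apply: eq_bigr => i _; rewrite deriveE.
Qed.

(** Product rule for y |-> 'd f y (Y y) = sum_i (Y y)_i *: 'D_(e_i) f y. *)
Lemma is_diff_diff_field U f Y x : open U -> U x -> Ck_on U 2 f ->
  differentiable Y x ->
  is_diff x (fun y => 'd f y (Y y))
    (fun u => 'd f x ('d Y x u) + \sum_(i < n) Y x 0 i *: 'D_u ('D_(e i) f) x).
Proof.
move=> oU Ux f2 dY; have f1 := Ck_onS f2; have [fd fD] := f2.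
have dYi i : is_diff x (fun y => Y y 0 i) (fun u => 'd Y x u 0 i).
  have dc : is_diff (Y x) (mx_coord 0 i) (mx_coord 0 i).
    have c : continuous (@mx_coord R 1 n 0 i).
      by move=> M; exact: (differentiable_continuous (@differentiable_coord R _ _ M 0 i)).
    by split; [exact: linear_differentiable|exact: diff_lin].
  exact: (is_diff_comp (differentiableP dY) dc).
have dD i : is_diff x ('D_(e i) f) (fun u => 'D_u ('D_(e i) f) x).
  have [/(_ x Ux) dDi _] := fD (e i).
  by split=> //; apply/funext => u; rewrite deriveE.
have := is_diff_sum (index_enum 'I_n) (fun i => is_diff_scale (dYi i) (dD i)).
case=> h1 h2.
have nE : \near x, \sum_(i < n) Y x 0 i *: 'D_(e i) f x = 'd f x (Y x).
  apply: filterS (open_nbhs_nbhs (conj oU Ux)) => y Uy.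
  by rewrite (diff_coordsE _ Uy f1).
split; first exact: near_eq_differentiable nE h1.
rewrite (near_eq_diff nE h1) h2; apply/funext => u.
by rewrite big_split /= addrC (diff_coordsE _ Ux f1).
Qed.

Lemma smooth_on_diff_field U f Y : open U -> smooth_on U f -> smooth_on U Y ->
  smooth_on U (fun x => 'd f x (Y x)).
Proof.
move=> oU fS YS k.
have fD i : Ck_on U k ('D_(e i) f) by have [_ /(_ (e i))] := fS k.+1.
have h i := Ck_on_scale oU (Ck_on_coord 0 i oU (YS k)) (fD i).
apply: eq_Ck_on oU _ (Ck_on_sum (index_enum 'I_n) oU h) => x Ux.
by rewrite (diff_coordsE _ Ux (fS 1%N)).
Qed.

(** For f real-valued this is X (Y f) - Y (X f) = [X, Y] f in coordinates;
    for f a change of coordinates or a local diffeomorphism it is the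
    naturality of the bracket. The second derivatives of f enter as a form in
    X x and Y x, and cancel because that form is symmetric. *)
Lemma diff_field_commutator U f X Y x : open U -> U x -> Ck_on U 2 f ->
  (forall u v, 'D_u ('D_v f) x = 'D_v ('D_u f) x) ->
  differentiable X x -> differentiable Y x ->
  'd (fun y => 'd f y (Y y)) x (X x) - 'd (fun y => 'd f y (X y)) x (Y x)
  = 'd f x ('d Y x (X x) - 'd X x (Y x)).
Proof.
move=> oU Ux f2 fsym dX dY; have [fd fD] := f2.
have [_ /(congr1 (@^~ (Y x))) EX] := is_diff_diff_field oU Ux f2 dX.
have [_ /(congr1 (@^~ (X x))) EY] := is_diff_diff_field oU Ux f2 dY.
apply: etrans (congr2 (fun a b => a - b) EY EX) _ => /=.
have sumE (u v : E) : \sum_(i < n) u 0 i *: 'D_v ('D_(e i) f) x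
    = \sum_(i < n) \sum_(j < n) (u 0 i * v 0 j) *: 'D_(e j) ('D_(e i) f) x.
  apply: eq_bigr => i _; have fDi := fD (e i); have [/(_ x Ux) dDi _] := fDi.
  rewrite (deriveE _ dDi) (diff_coordsE _ Ux fDi) scaler_sumr.
  by apply: eq_bigr => j _; rewrite scalerA.
have sym : \sum_(i < n) Y x 0 i *: 'D_(X x) ('D_(e i) f) x
    = \sum_(i < n) X x 0 i *: 'D_(Y x) ('D_(e i) f) x.
  apply: etrans (sumE _ _) (etrans _ (esym (sumE _ _))).
  rewrite exchange_big /=; apply: eq_bigr => i _; apply: eq_bigr => j _.
  by rewrite mulrC fsym.
apply: etrans (congr1 (fun c => _ + c - (_ + _)) sym) _.
rewrite opprD addrACA subrr addr0; apply: esym; exact: linearB.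
Qed.

End Pushforward.

(** Mean value theorem on the segment from x to y, entry by entry. *)
Lemma eq_on_ball_of_diff0 (R : realType) (V : normedModType R) m n
    (f : V -> 'M[R]_(m, n)) (x y : V) (r : R) :
  (forall z, ball x r z -> is_diff z f 0) -> ball x r y -> f y = f x.
Proof.
move=> fd xry; apply/matrixP => i j.
have inb s : 0 <= s <= 1 -> ball x r (x + s *: (y - x)).
  move=> /andP[s0 s1]; move: xry; rewrite -!ball_normE /=.
  rewrite opprD addrA subrr sub0r normrN normrZ ger0_norm // distrC.
  by apply: le_lt_trans; rewrite ler_piMl.
have fijd z : ball x r z -> differentiable (fun z => f z i j) z.
  move=> /fd[dz _]; apply: (@differentiable_comp _ _ _ _ f (fun M => M i j)) dz _.
  exact: differentiable_coord.
have [s s01] := @mean_value_line R V (fun z => f z i j) x (y - x) 1 ltr01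
  (fun s s01 => fijd _ (inb s s01)).
have [dz zE] := fd _ (inb s s01).
have -> : x + 1 *: (y - x) = y by rewrite scale1r addrC subrK.
rewrite (derive_coord _ _ _ dz) (deriveE _ dz) zE mxE mulr0.
by move=> /eqP; rewrite subr_eq0 => /eqP.
Qed.

(** * Charts and vector fields *)
Section Charts.
Variables (R : realType) (n : nat) (M : manifoldType R n).
Local Notation E := 'rV[R]_n.
Implicit Types (p q r z : M) (x : E) (X Y : M -> E).

Definition transition p q : E -> E := coord (chart_at p) \o pt (chart_at q).

Lemma dom_pt p x : chart_img p x -> dom (chart_at p) (pt (chart_at p) x).
Proof. by case=> z zd <-; rewrite coordK. Qed.

Lemma ptK p x : chart_img p x -> coord (chart_at p) (pt (chart_at p) x) = x.
Proof. by case=> z zd <-; rewrite coordK. Qed.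

Lemma mem_chart_img p z : dom (chart_at p) z -> chart_img p (coord (chart_at p) z).
Proof. by move=> zd; exists z. Qed.

Lemma mem_base_coord p : chart_img p (base_coord p).
Proof. exact/mem_chart_img/mem_chart_at. Qed.

Lemma pt_base_coord p : pt (chart_at p) (base_coord p) = p.
Proof. exact/coordK/mem_chart_at. Qed.

Lemma nbhs_dom p z : dom (chart_at p) z -> nbhs z (dom (chart_at p)).
Proof. by move=> zd; apply: open_nbhs_nbhs; split=> //; exact: open_dom. Qed.

Lemma nbhs_chart_img p x : chart_img p x -> nbhs x (chart_img p).
Proof. by move=> px; apply: open_nbhs_nbhs; split=> //; exact: open_img. Qed.

Lemma nbhs_pt p z (N : set M) : dom (chart_at p) z -> nbhs z N ->
  nbhs (coord (chart_at p) z) (pt (chart_at p) @^-1` N).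
Proof.
move=> zd zN; apply: (pt_continuous (mem_chart_img zd)).
by rewrite coordK.
Qed.

Lemma nbhs_coord p z (N : set E) : dom (chart_at p) z ->
  nbhs (coord (chart_at p) z) N -> nbhs z (coord (chart_at p) @^-1` N).
Proof. by move=> zd zN; apply: (coord_continuous zd). Qed.

Lemma nbhs_pt_base p (N : set M) : nbhs p N ->
  nbhs (base_coord p) (pt (chart_at p) @^-1` N).
Proof. by move=> pN; apply: nbhs_pt => //; exact: mem_chart_at. Qed.

Lemma open_transition_dom p q :
  open (coord (chart_at q) @` (dom (chart_at p) `&` dom (chart_at q))).
Proof.
rewrite openE => _ [z [zp zq] <-]; rewrite /interior.
apply: filterS2 (nbhs_chart_img (mem_chart_img zq)) (nbhs_pt zq (nbhs_dom zp)).
move=> x qx /= xp; exists (pt (chart_at q) x); last exact: ptK.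
by split=> //; exact: dom_pt.
Qed.

Lemma differentiable_transition p q z :
  dom (chart_at p) z -> dom (chart_at q) z ->
  differentiable (transition p q) (coord (chart_at q) z).
Proof.
move=> zp zq; have [+ _] := transition_smooth p q 1%N.
by apply; exists z.
Qed.

(** Chain rule for a change of chart in the source. With F a coordinate map
    it is the cocycle rule of the transition maps. *)
Lemma is_diff_change_chart (W : normedModType R) (F : M -> W) q r z :
  dom (chart_at q) z -> dom (chart_at r) z ->
  differentiable (F \o pt (chart_at q)) (coord (chart_at q) z) ->
  is_diff (coord (chart_at r) z) (F \o pt (chart_at r))
    ('d (F \o pt (chart_at q)) (coord (chart_at q) z)
     \o 'd (transition q r) (coord (chart_at r) z)).
Proof.
move=> zq zr dF.
have tE : transition q r (coord (chart_at r) z) = coord (chart_at q) z.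
  by rewrite /transition /= coordK.
have dt := differentiableP (differentiable_transition zq zr).
have dF' : is_diff (transition q r (coord (chart_at r) z)) (F \o pt (chart_at q))
    ('d (F \o pt (chart_at q)) (coord (chart_at q) z)).
  by rewrite tE; exact: differentiableP.
apply: near_eq_is_diff (is_diff_comp dt dF').
apply: filterS (nbhs_pt zr (nbhs_dom zq)) => x /= xq.
by rewrite /transition /= coordK.
Qed.

Lemma diff_transition_id p : 'd (transition p p) (base_coord p) = id :> (E -> E).
Proof.
have nE : \forall x \near base_coord p, id x = transition p p x.
  apply: filterS (nbhs_chart_img (mem_base_coord p)) => x px.
  by rewrite /transition /= ptK.
by have [_ ->] := near_eq_is_diff nE (is_diff_id _).
Qed.

Lemma field_in_chart_coord p z X : dom (chart_at p) z ->
  field_in_chart p X (coord (chart_at p) z) = 'd (transition p z) (base_coord z) (X z).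
Proof. by move=> zp; rewrite /field_in_chart coordK. Qed.

Lemma field_in_chart_base p X : field_in_chart p X (base_coord p) = X p.
Proof.
by rewrite field_in_chart_coord ?diff_transition_id //; exact: mem_chart_at.
Qed.

Lemma field_change_chart p q z X : dom (chart_at p) z -> dom (chart_at q) z ->
  field_in_chart p X (coord (chart_at p) z)
  = 'd (transition p q) (coord (chart_at q) z)
       (field_in_chart q X (coord (chart_at q) z)).
Proof.
move=> zp zq; rewrite !field_in_chart_coord //.
exact: (is_diffE (is_diff_change_chart zq (mem_chart_at z)
  (differentiable_transition zp zq))).
Qed.

(** Smoothness of a field has to be known only near each point p and in the
    chart at p: other charts differ by a smooth transition map. *)
Lemma smooth_field_local X :
  (forall p, smooth_near (field_in_chart p X) (base_coord p)) -> smooth_field X.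
Proof.
move=> Xs p k; apply: Ck_on_local => _ [z zp <-].
have [U [oU Uz] XS] := Xs z.
have zz : dom (chart_at z) z := mem_chart_at z.
pose V := coord (chart_at p) @` (dom (chart_at z) `&` dom (chart_at p)).
(* The part of the chart at p that the chart at z maps into U; the interior
   makes it open, as the transition map is continuous on V only. *)
pose V' := (V `&` transition z p @^-1` U)°.
have sV' : V' `<=` V `&` transition z p @^-1` U by exact: interior_subset.
have oV' : open V' by exact: open_interior.
exists V'.
  split=> //; apply: filterI.
    by apply: open_nbhs_nbhs; split; [exact: open_transition_dom|exists z].
  apply: (differentiable_continuous (differentiable_transition zz zp)).
  rewrite /transition /= coordK //; exact: open_nbhs_nbhs.
pose U2 := U `&` coord (chart_at z) @` (dom (chart_at p) `&` dom (chart_at z)).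
have oU2 : open U2 by apply: openI => //; exact: open_transition_dom.
have tS := Ck_onW (fun x (xV : V' x) => (sV' x xV).1) (transition_smooth z p k).
have tU x : V' x -> U2 (transition z p x).
  move=> /sV'[[w [wz wp] <-] ?]; split=> //.
  by exists w => //; rewrite /transition /= coordK.
have GS := smooth_on_diff_field oU2
  (fun j => Ck_onW (@subIsetr _ _ _) (transition_smooth p z j))
  (fun j => Ck_onW (@subIsetl _ _ _) (XS j)).
apply: eq_Ck_on oV' _ (Ck_on_comp oV' tU tS (GS k)) => x /sV'[[w [wz wp] <-] _].
by rewrite (field_change_chart _ wp wz) /= /transition /= coordK.
Qed.

Lemma field_deriv_chart X (f : M -> R) p x : smooth_fun f -> chart_img p x ->
  field_deriv X f (pt (chart_at p) x)
  = 'd (f \o pt (chart_at p)) x (field_in_chart p X x).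
Proof.
move=> fS [z zp <-]; rewrite coordK // field_in_chart_coord //.
have [fd _] := fS p 1%N.
have [_ h] := is_diff_change_chart zp (mem_chart_at z) (fd _ (mem_chart_img zp)).
by rewrite /field_deriv [LHS](congr1 (@^~ (X z)) h).
Qed.

Lemma smooth_field_deriv X (f : M -> R) :
  smooth_fun f -> smooth_field X -> smooth_fun (field_deriv X f).
Proof.
move=> fS XS p k; have oI : open (chart_img p) by exact: open_img.
apply: eq_Ck_on oI _ (smooth_on_diff_field oI (fS p) (XS p) k) => x px.
by rewrite /= field_deriv_chart.
Qed.

Lemma field_in_chart_add p X Y x : field_in_chart p (fun q => X q + Y q) x
  = field_in_chart p X x + field_in_chart p Y x.
Proof. by rewrite /field_in_chart linearD. Qed.

Lemma field_in_chart_scale p (f : M -> R) X x :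
  field_in_chart p (fun q => f q *: X q) x
  = f (pt (chart_at p) x) *: field_in_chart p X x.
Proof. by rewrite /field_in_chart linearZ. Qed.

Lemma smooth_fieldD X Y : smooth_field X -> smooth_field Y ->
  smooth_field (fun q => X q + Y q).
Proof.
move=> XS YS p k; have oI : open (chart_img p) by exact: open_img.
apply: eq_Ck_on oI _ (Ck_onD oI (XS p k) (YS p k)) => x px.
by rewrite field_in_chart_add.
Qed.

Lemma smooth_fieldZ (f : M -> R) X : smooth_fun f -> smooth_field X ->
  smooth_field (fun q => f q *: X q).
Proof.
move=> fS XS p k; have oI : open (chart_img p) by exact: open_img.
apply: eq_Ck_on oI _ (Ck_on_scale oI (fS p k) (XS p k)) => x px.
by rewrite field_in_chart_scale.
Qed.

Lemma smooth_fun_cst (c : R) : smooth_fun (fun _ : M => c).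
Proof. move=> p k; exact: Ck_on_cst. Qed.

Lemma field_deriv_cst X (c : R) p : field_deriv X (fun _ => c) p = 0.
Proof. by rewrite /field_deriv [LHS](congr1 (@^~ (X p)) (diff_cst _ _)). Qed.

Lemma differentiable_field p X x : smooth_field X -> chart_img p x ->
  differentiable (field_in_chart p X) x.
Proof. by move=> XS; have [+ _] := XS p 1%N; exact. Qed.

(** This identity is what makes the curvature linear over functions in its
    last argument. *)
Lemma field_deriv_bracket X Y (f : M -> R) p :
  smooth_field X -> smooth_field Y -> smooth_fun f ->
  field_deriv (lie_bracket X Y) f p
  = field_deriv X (field_deriv Y f) p - field_deriv Y (field_deriv X f) p.
Proof.
move=> XS YS fS; have oI : open (chart_img p) by exact: open_img.
have pI := mem_base_coord p.
have dE Z x : chart_img p x -> (field_deriv Z f \o pt (chart_at p)) x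
    = 'd (f \o pt (chart_at p)) x (field_in_chart p Z x).
  by move=> px; rewrite /= field_deriv_chart.
have E Z Z' : smooth_field Z -> field_deriv Z' (field_deriv Z f) p
   = 'd (fun x => 'd (f \o pt (chart_at p)) x (field_in_chart p Z x))
       (base_coord p) (field_in_chart p Z' (base_coord p)).
  move=> ZS; rewrite field_in_chart_base /field_deriv.
  have [dF _] := smooth_on_diff_field oI (fS p) (ZS p) 1%N.
  apply: (congr1 (@^~ (Z' p))); apply: near_eq_diff (dF _ pI).
  by apply: filterS (nbhs_chart_img pI) => x /(dE Z) ->.
apply: etrans (esym (congr2 (fun a b => a - b) (E _ _ YS) (E _ _ XS))).
rewrite (diff_field_commutator oI pI (fS p 2%N)).
- by rewrite !field_in_chart_base.
- by move=> u v; exact: schwarz_scalar oI pI (fS p 2%N).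
- exact: differentiable_field.
- exact: differentiable_field.
Qed.

End Charts.

(** * Differentials of maps between manifolds *)
Section Maps.
Variables (R : realType) (m n : nat) (M : manifoldType R m) (N : manifoldType R n).
Implicit Types (phi : M -> N) (p z : M) (q : N) (x : 'rV[R]_m).

Definition local_rep phi p : 'rV[R]_m -> 'rV[R]_n :=
  fun x => coord (chart_at (phi p)) (phi (pt (chart_at p) x)).

Definition tangent phi p : 'rV[R]_m -> 'rV[R]_n := 'd (local_rep phi p) (base_coord p).

Definition chart_differentiable phi p : Prop :=
  {for p, continuous phi} /\ differentiable (local_rep phi p) (base_coord p).

Definition smooth_map phi : Prop :=
  continuous phi /\ forall p, smooth_near (local_rep phi p) (base_coord p).

Lemma local_rep_base phi p : local_rep phi p (base_coord p) = base_coord (phi p).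
Proof. by rewrite /local_rep pt_base_coord. Qed.

Lemma smooth_map_differentiable phi p : smooth_map phi -> chart_differentiable phi p.
Proof.
case=> phic /(_ p)[U [oU Up] US]; split; first exact: phic.
by have [+ _] := US 1%N; exact.
Qed.

Lemma nbhs_local_rep phi p : {for p, continuous phi} ->
  \forall x \near base_coord p, dom (chart_at (phi p)) (phi (pt (chart_at p) x)).
Proof.
move=> phic; apply: (nbhs_pt_base (N := phi @^-1` dom (chart_at (phi p)))).
exact/phic/nbhs_dom/mem_chart_at.
Qed.

(** The differential of phi at z can be read in any pair of charts around z
    and phi z; 'tangent' uses the charts selected at these points. *)
Lemma is_diff_rep phi p q z : chart_differentiable phi z ->
  dom (chart_at p) z -> dom (chart_at q) (phi z) ->
  is_diff (coord (chart_at p) z)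
    (fun x => coord (chart_at q) (phi (pt (chart_at p) x)))
    (fun v => 'd (transition q (phi z)) (base_coord (phi z))
       (tangent phi z ('d (transition z p) (coord (chart_at p) z) v))).
Proof.
move=> [phic dphi] zp zq.
have dt := differentiable_transition zq (mem_chart_at (phi z)).
have dt' : is_diff (local_rep phi z (base_coord z)) (transition q (phi z))
    ('d (transition q (phi z)) (base_coord (phi z))).
  by rewrite local_rep_base; exact: differentiableP.
have d1 : is_diff (base_coord z) ((coord (chart_at q) \o phi) \o pt (chart_at z))
    ('d (transition q (phi z)) (base_coord (phi z)) \o tangent phi z).
  apply: near_eq_is_diff (is_diff_comp (differentiableP dphi) dt').
  apply: filterS (nbhs_local_rep phic) => x xd.
  by rewrite /= /transition /local_rep /= coordK.
have [d2 d2E] := is_diff_change_chart (F := coord (chart_at q) \o phi)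
  (mem_chart_at z) zp (@ex_diff _ _ _ _ _ _ _ d1).
split; first exact: d2.
apply: etrans d2E _; apply/funext => v /=; exact: is_diffE.
Qed.

(** phi-related fields, at neighbouring points, in the fixed charts at p and
    phi p; a pointwise relation between tangent vectors becomes one that can
    be differentiated. *)
Lemma nbhs_related phi (X : M -> 'rV[R]_m) (Y : N -> 'rV[R]_n) p :
  (forall z, chart_differentiable phi z) ->
  (forall z, Y (phi z) = tangent phi z (X z)) ->
  \forall x \near base_coord p, field_in_chart (phi p) Y (local_rep phi p x)
    = 'd (local_rep phi p) x (field_in_chart p X x).
Proof.
move=> phid XY.
apply: filterS2 (nbhs_chart_img (mem_base_coord p)) (nbhs_local_rep (phid p).1).
move=> _ [z zp <-]; rewrite /local_rep coordK // => zd.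
rewrite !field_in_chart_coord // XY.
apply: esym; apply: etrans (is_diffE (is_diff_rep (phid z) zp zd) _) _ => /=.
congr ('d _ _ (tangent _ _ _)).
apply: etrans (esym (is_diffE (is_diff_change_chart (F := coord (chart_at z)) zp
  (mem_chart_at z) _) _)) _; first exact: differentiable_transition (mem_chart_at z) zp.
by apply: (congr1 (@^~ (X z)) (diff_transition_id z)).
Qed.

(** Differentiate the relation Y' (phi x) = 'd phi x (Y x) along X, and the
    same with X and Y exchanged. *)
Lemma lie_bracket_related phi (X Y : M -> 'rV[R]_m) (X' Y' : N -> 'rV[R]_n) p :
  smooth_map phi ->
  smooth_field X -> smooth_field Y -> smooth_field X' -> smooth_field Y' ->
  (forall z, X' (phi z) = tangent phi z (X z)) ->
  (forall z, Y' (phi z) = tangent phi z (Y z)) ->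
  lie_bracket X' Y' (phi p) = tangent phi p (lie_bracket X Y p).
Proof.
move=> phiS XS YS XS' YS' XX YY.
have phid z := smooth_map_differentiable z phiS.
have [U [oU Up] FS] := phiS.2 p.
have dF := (phid p).2.
have H (Z : M -> 'rV[R]_m) Z' v : smooth_field Z -> smooth_field Z' ->
    (forall z, Z' (phi z) = tangent phi z (Z z)) ->
    'd (field_in_chart (phi p) Z') (base_coord (phi p)) (tangent phi p v)
    = 'd (fun x => 'd (local_rep phi p) x (field_in_chart p Z x)) (base_coord p) v.
  move=> ZS ZS' ZZ.
  have dZ' : is_diff (local_rep phi p (base_coord p)) (field_in_chart (phi p) Z')
      ('d (field_in_chart (phi p) Z') (base_coord (phi p))).
    rewrite local_rep_base; apply: differentiableP.
    exact: differentiable_field ZS' (mem_base_coord _).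
  have h := near_eq_is_diff (nbhs_related p phid ZZ)
    (is_diff_comp (differentiableP dF) dZ').
  exact: esym (is_diffE h v).
have pI := mem_base_coord p.
rewrite /lie_bracket {1}XX {1}YY.
apply: etrans (congr2 (fun a b => a - b) (H _ _ _ YS YS' YY) (H _ _ _ XS XS' XX)) _.
have sym u v := schwarz u v oU Up (FS 2%N).
have := diff_field_commutator oU Up (FS 2%N) sym
  (differentiable_field XS pI) (differentiable_field YS pI).
by rewrite !field_in_chart_base.
Qed.

End Maps.

Section TangentComp.
Variables (R : realType) (l m n : nat).
Variables (M : manifoldType R l) (N : manifoldType R m) (P : manifoldType R n).

Lemma is_diff_local_rep_comp (phi : M -> N) (psi : N -> P) p :
  chart_differentiable phi p -> chart_differentiable psi (phi p) ->
  is_diff (base_coord p) (local_rep (psi \o phi) p)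
    (tangent psi (phi p) \o tangent phi p).
Proof.
move=> [phic dphi] [psic dpsi].
have dpsi' : is_diff (local_rep phi p (base_coord p)) (local_rep psi (phi p))
    (tangent psi (phi p)) by rewrite local_rep_base; exact: differentiableP.
apply: near_eq_is_diff (is_diff_comp (differentiableP dphi) dpsi').
apply: filterS (nbhs_local_rep phic) => x xd.
by rewrite /local_rep /= coordK.
Qed.

Lemma chart_differentiable_comp (phi : M -> N) (psi : N -> P) p :
  chart_differentiable phi p -> chart_differentiable psi (phi p) ->
  chart_differentiable (psi \o phi) p.
Proof.
move=> dphi dpsi; split; last by have [] := is_diff_local_rep_comp dphi dpsi.
by apply: continuous_comp; [case: dphi|case: dpsi].
Qed.

Lemma tangent_comp (phi : M -> N) (psi : N -> P) p v :
  chart_differentiable phi p -> chart_differentiable psi (phi p) ->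
  tangent (psi \o phi) p v = tangent psi (phi p) (tangent phi p v).
Proof. by move=> dphi dpsi; exact: (is_diffE (is_diff_local_rep_comp dphi dpsi)). Qed.

End TangentComp.

(** * Locally constant maps *)

Section LocallyConstant.
Variables (R : realType) (m : nat) (M : manifoldType R m).

Lemma tangent_id (p : M) v : tangent (fun q => q) p v = v.
Proof. exact: (congr1 (@^~ v) (diff_transition_id p)). Qed.

Lemma locally_constant_row k (f : M -> 'rV[R]_k) p :
  (\forall q \near p, is_diff (base_coord q) (f \o pt (chart_at q)) 0) ->
  \forall q \near p, f q = f p.
Proof.
move=> fd; have pp := mem_chart_at p.
have [r /= r0 sr] := (@nbhs_ballP R 'rV[R]_m _ _).1
  (filterI (nbhs_chart_img (mem_base_coord p)) (nbhs_pt_base fd)).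
have rN : nbhs (base_coord p) (ball (base_coord p) r) by exact: nbhsx_ballx.
apply: filterS2 (nbhs_dom pp) (nbhs_coord pp rN) => q qp rq.
have fd0 x : ball (base_coord p) r x -> is_diff x (f \o pt (chart_at p)) 0.
  move=> /sr[[z zp <-]] /=; rewrite coordK // => fz.
  have [dz dzE] := is_diff_change_chart (mem_chart_at z) zp (@ex_diff _ _ _ _ _ _ _ fz).
  split=> //; apply/funext => v; apply: etrans (congr1 (@^~ v) dzE) _ => /=.
  exact: is_diffE.
have := eq_on_ball_of_diff0 fd0 rq.
by rewrite /= coordK // pt_base_coord.
Qed.

(** Near p the values of phi lie in one chart, so the vector-valued case
    applies to the coordinates of phi there. *)
Lemma locally_constant_map n (N : manifoldType R n) (phi : M -> N) p :
  continuous phi -> (forall q, is_diff (base_coord q) (local_rep phi q) 0) ->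
  \forall q \near p, phi q = phi p.
Proof.
move=> phic dphi.
have pp := mem_chart_at (phi p).
have pN : \forall q \near p, dom (chart_at (phi p)) (phi q) := phic p _ (nbhs_dom pp).
have phid q : chart_differentiable phi q.
  by split; [exact: phic|case: (dphi q)].
have dc : \forall q \near p, is_diff (base_coord q)
    ((coord (chart_at (phi p)) \o phi) \o pt (chart_at q)) 0.
  apply: filterS pN => q qd.
  have [h1 h2] := is_diff_rep (phid q) (mem_chart_at q) qd.
  split=> //; apply: etrans h2 _; apply/funext => v.
  by rewrite /tangent (is_diffE (dphi q)) linear0.
apply: filterS2 pN (locally_constant_row dc) => q qd /= E.
by rewrite -(coordK qd) E coordK.
Qed.

End LocallyConstant.

Lemma connected_locally_constant (T : topologicalType) (U : Type) (f : T -> U) :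
  connected [set: T] -> (forall p, \forall q \near p, f q = f p) ->
  forall p q, f p = f q.
Proof.
move=> Tc fl p q; pose B := [set z | f z = f p].
have oB : open B.
  rewrite openE => z Bz; apply: (filterS _ (fl z)) => y.
  by rewrite /B /= => ->.
have cB : closed B.
  rewrite -openC openE /= => z Bz; apply: (filterS _ (fl z)) => y yz.
  by rewrite /setC /B /= yz; exact: Bz.
have BT : B = [set: T].
  by apply: Tc; [exists p|exists B; rewrite ?setTI|exists B; rewrite ?setTI].
have : B q by rewrite BT.
by move=> ->.
Qed.

(** * Maps of two variables *)
Section Slices.
Variables (R : realType) (V V' W : normedModType R).

Definition pair_l (x : V) : V * V' := (x, 0).
Definition pair_r (y : V') : V * V' := (0, y).

Lemma pair_l_is_linear : linear pair_l.
Proof. by move=> a x y; rewrite /pair_l; congr (_, _); rewrite /= scaler0 addr0. Qed.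

Lemma pair_r_is_linear : linear pair_r.
Proof. by move=> a x y; rewrite /pair_r; congr (_, _); rewrite /= scaler0 addr0. Qed.

HB.instance Definition _ := GRing.isLinear.Build R V (V * V')%type _ pair_l pair_l_is_linear.
HB.instance Definition _ := GRing.isLinear.Build R V' (V * V')%type _ pair_r pair_r_is_linear.

Lemma continuous_pair_l : continuous pair_l.
Proof. by move=> x; apply: cvg_pair; [exact: cvg_id|exact: cvg_cst]. Qed.

Lemma continuous_pair_r : continuous pair_r.
Proof. by move=> x; apply: cvg_pair; [exact: cvg_cst|exact: cvg_id]. Qed.

Variable f : V * V' -> W.

Lemma is_diff_slice_l x y : differentiable f (x, y) ->
  is_diff x (fun x => f (x, y)) (fun u => 'd f (x, y) (u, 0)).
Proof.
move=> df.
exact: (is_diff_comp (is_diff_pair (is_diff_id x) (is_diff_cst y x)) (differentiableP df)).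
Qed.

Lemma is_diff_slice_r x y : differentiable f (x, y) ->
  is_diff y (fun y => f (x, y)) (fun v => 'd f (x, y) (0, v)).
Proof.
move=> df.
exact: (is_diff_comp (is_diff_pair (is_diff_cst x y) (is_diff_id y)) (differentiableP df)).
Qed.

Lemma smooth_near_slice_l x y : smooth_near f (x, y) -> smooth_near (fun x => f (x, y)) x.
Proof.
case=> U [oU Uxy] fS.
have E z : (0, y) + pair_l z = (z, y) by congr (_, _); rewrite /= ?add0r ?addr0.
pose A z := (0, y) + pair_l z.
have Ac : continuous A.
  by move=> z; apply: continuousD; [exact: cst_continuous|exact: continuous_pair_l].
have oU' : open (A @^-1` U) by apply: open_comp => // z _; exact: Ac.
exists (A @^-1` U); first by split=> //; rewrite /preimage /= /A E.
move=> k; have h := Ck_on_affine oU' continuous_pair_l (fun z Uz => Uz) (fS k).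
by apply: eq_Ck_on oU' _ h => z _; rewrite E.
Qed.

Lemma smooth_near_slice_r x y : smooth_near f (x, y) -> smooth_near (fun y => f (x, y)) y.
Proof.
case=> U [oU Uxy] fS.
have E z : (x, 0) + pair_r z = (x, z) by congr (_, _); rewrite /= ?add0r ?addr0.
pose A z := (x, 0) + pair_r z.
have Ac : continuous A.
  by move=> z; apply: continuousD; [exact: cst_continuous|exact: continuous_pair_r].
have oU' : open (A @^-1` U) by apply: open_comp => // z _; exact: Ac.
exists (A @^-1` U); first by split=> //; rewrite /preimage /= /A E.
move=> k; have h := Ck_on_affine oU' continuous_pair_r (fun z Uz => Uz) (fS k).
by apply: eq_Ck_on oU' _ h => z _; rewrite E.
Qed.

End Slices.

Lemma smooth_near_derive (R : realType) (V W : normedModType R) (f : V -> W) x v :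
  smooth_near f x -> smooth_near ('D_v f) x.
Proof. by case=> U oU fS; exists U => // k; have [_] := fS k.+1; exact. Qed.

Lemma smooth_near_eq (R : realType) (V W : normedModType R) (f g : V -> W) x :
  (\forall y \near x, f y = g y) -> smooth_near f x -> smooth_near g x.
Proof.
move=> fg [U [oU Ux] fS].
have oV : open (U `&` [set y | f y = g y]°) by apply: openI => //; exact: open_interior.
exists (U `&` [set y | f y = g y]°); first by split.
move=> k; apply: eq_Ck_on oV _ (Ck_onW (@subIsetl _ _ _) (fS k)) => y [_].
exact: interior_subset.
Qed.

(** * Left-invariant vector fields *)

Section LieGroup.
Variables (R : realType) (n : nat) (G : lieGroupType R n).
Local Notation E := 'rV[R]_n.
Local Notation one := (1%g : G).
Implicit Types (a b p q : G) (u v : E).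

Definition mul_rep a b (z : E * E) : E :=
  coord (chart_at (a * b)%g) (pt (chart_at a) z.1 * pt (chart_at b) z.2)%g.

Lemma smooth_near_mul_rep a b : smooth_near (mul_rep a b) (base_coord a, base_coord b).
Proof. exact: mulg_smooth. Qed.

Lemma smooth_mulgl a : smooth_map (fun p : G => (a * p)%g).
Proof.
split=> [p|p].
  apply: (@continuous_comp _ _ _ (fun p : G => (a, p)) (fun ab => (ab.1 * ab.2)%g)).
    by apply: cvg_pair; [exact: cvg_cst|exact: cvg_id].
  exact: mulg_continuous.
have := smooth_near_slice_r (smooth_near_mul_rep a p).
by under eq_fun do rewrite /mul_rep /= pt_base_coord.
Qed.

Lemma smooth_mulgr b : smooth_map (fun p : G => (p * b)%g).
Proof.
split=> [p|p].
  apply: (@continuous_comp _ _ _ (fun p : G => (p, b)) (fun ab => (ab.1 * ab.2)%g)).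
    by apply: cvg_pair; [exact: cvg_id|exact: cvg_cst].
  exact: mulg_continuous.
have := smooth_near_slice_l (smooth_near_mul_rep p b).
by under eq_fun do rewrite /mul_rep /= pt_base_coord.
Qed.

Lemma smooth_invg : smooth_map (fun p : G => (p^-1)%g).
Proof. by split=> [p|p]; [exact: invg_continuous|exact: invg_smooth]. Qed.

(** The left-invariant field with value v at 1; its value at a is expressed
    in the chart at a * 1 = a. *)
Definition left_field v : G -> E := fun a => tangent (fun p : G => (a * p)%g) one v.

Lemma left_field_translate a p v :
  left_field v (a * p)%g = left_translation_diff a p (left_field v p).
Proof.
rewrite /left_field.
have -> : (fun q : G => (a * p * q)%g) = (fun q : G => (a * q)%g) \o (fun q => (p * q)%g).
  by apply/funext => q /=; rewrite mulgA.
rewrite tangent_comp; try exact/smooth_map_differentiable/smooth_mulgl.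
by rewrite mulg1.
Qed.

(** In the chart at p, a left-invariant field is a partial derivative of the
    multiplication, and therefore smooth. *)
Lemma near_left_field p v : \forall x \near base_coord p,
  field_in_chart p (left_field v) x = 'D_(0, v) (mul_rep p one) (x, base_coord one).
Proof.
have [U [oU Up] mS] := smooth_near_mul_rep p one.
have nU : \forall x \near base_coord p, U (x, base_coord one).
  have [d _] := is_diff_pair (is_diff_id (base_coord p))
    (is_diff_cst (base_coord one) (base_coord p)).
  have c := differentiable_continuous d.
  exact: (c _ (open_nbhs_nbhs (conj oU Up))).
apply: filterS2 (nbhs_chart_img (mem_base_coord p)) nU => _ [z zp <-] Uz.
have [md _] := mS 1%N.
rewrite (deriveE _ (md _ Uz)) field_in_chart_coord //.
have d1 := is_diff_slice_r (md _ Uz).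
rewrite -(is_diffE d1).
have E1 : (z * 1)%g = z by rewrite mulg1.
have zp' : dom (chart_at p) (z * 1)%g by rewrite mulg1.
have := is_diff_rep (smooth_map_differentiable one (smooth_mulgl z))
  (mem_chart_at one) zp'.
move=> /is_diffE /(_ v) h.
have fE : (fun y => mul_rep p one (coord (chart_at p) z, y))
    = (fun x => coord (chart_at p) (z * pt (chart_at one) x)%g).
  by apply/funext => y; rewrite /mul_rep /= mulg1 coordK.
rewrite fE; apply: esym; apply: etrans h _.
have idv : 'd (transition one one) (base_coord one) v = v.
  exact: (congr1 (@^~ v) (diff_transition_id one)).
apply: etrans (congr1 (fun w => 'd _ _ (tangent _ _ w)) idv) _.
exact: (congr1 (fun q => 'd (transition p q) (base_coord q) (left_field v z)) E1).
Qed.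

Lemma smooth_left_field v : smooth_field (left_field v).
Proof.
apply: smooth_field_local => p.
have h := smooth_near_slice_l (smooth_near_derive (0, v) (smooth_near_mul_rep p one)).
by apply: smooth_near_eq h; apply: filterS (near_left_field p v) => x ->.
Qed.

Lemma left_field_left_invariant v : left_invariant_field (left_field v).
Proof. by split=> [|a p]; [exact: smooth_left_field|exact: left_field_translate]. Qed.

Lemma left_field1 v : left_field v one = v.
Proof.
rewrite /left_field.
have -> : (fun p : G => (1 * p)%g) = (fun p => p) by apply/funext => p; rewrite mul1g.
exact: tangent_id.
Qed.

Lemma lie_bracket_left_invariant u v a p :
  lie_bracket (left_field u) (left_field v) (a * p)%g
  = left_translation_diff a p (lie_bracket (left_field u) (left_field v) p).
Proof.
apply: (@lie_bracket_related _ _ _ _ _ (fun q : G => (a * q)%g)).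
- exact: smooth_mulgl.
- exact: smooth_left_field.
- exact: smooth_left_field.
- exact: smooth_left_field.
- exact: smooth_left_field.
- by move=> z; exact: left_field_translate.
- by move=> z; exact: left_field_translate.
Qed.

End LieGroup.

(** * The adjoint representation *)
Section Adjoint.
Variables (R : realType) (n : nat) (G : lieGroupType R n).
Local Notation E := 'rV[R]_n.
Local Notation one := (1%g : G).
Implicit Types (a b p q : G) (u v w : E).

Local Notation e0 := (base_coord one).
Local Notation m0 := (mul_rep one one).

Definition conjugation a p : G := (a * p * a^-1)%g.

Definition Ad a v : E := tangent (conjugation a) one v.

Lemma conjugation1 a : conjugation a one = one.
Proof. by rewrite /conjugation mulg1 mulgV. Qed.

Lemma smooth_conjugation a p : chart_differentiable (conjugation a) p.
Proof.
apply: (@chart_differentiable_comp _ _ _ _ _ _ _ (fun p => a * p)%g (fun p => p * a^-1)%g).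
- exact/smooth_map_differentiable/smooth_mulgl.
- exact/smooth_map_differentiable/smooth_mulgr.
Qed.

Lemma is_diff_conjugation a : is_diff e0
  (fun y => coord (chart_at one) (conjugation a (pt (chart_at one) y))) (Ad a).
Proof.
have := differentiableP (smooth_conjugation a one).2.
by rewrite /Ad /tangent /local_rep conjugation1.
Qed.

Lemma Ad_mul a b v : Ad (a * b)%g v = Ad a (Ad b v).
Proof.
rewrite /Ad; have -> : conjugation (a * b)%g = conjugation a \o conjugation b.
  by apply/funext => p; rewrite /conjugation /= invgM !mulgA.
by rewrite tangent_comp ?conjugation1 //; exact: smooth_conjugation.
Qed.

Lemma Ad1 v : Ad one v = v.
Proof.
rewrite /Ad; have -> : conjugation one = (fun p => p).
  by apply/funext => p; rewrite /conjugation mul1g invg1 mulg1.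
exact: tangent_id.
Qed.

(** Differentiate a y = (a y a^-1) a with respect to y at 1, where x is the
    coordinate vector of a. *)
Lemma diff_mul_rep_Ad x v : chart_img one x ->
  differentiable m0 (x, e0) -> differentiable m0 (e0, x) ->
  'd m0 (x, e0) (0, v) = 'd m0 (e0, x) (Ad (pt (chart_at one) x) v, 0).
Proof.
move=> [a ad <-] dl dr; rewrite coordK //.
have d1 := is_diff_slice_r dl.
pose c y := coord (chart_at one) (conjugation a (pt (chart_at one) y)).
have dc : is_diff e0 c (Ad a) := is_diff_conjugation a.
have ce : c e0 = e0 by rewrite /c pt_base_coord conjugation1.
have d2 : is_diff (c e0) (fun z => m0 (z, coord (chart_at one) a))
    (fun w => 'd m0 (e0, coord (chart_at one) a) (w, 0)).
  by rewrite ce; exact: is_diff_slice_l.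
have nE : \forall y \near e0, m0 (c y, coord (chart_at one) a) = m0 (coord (chart_at one) a, y).
  have := nbhs_local_rep (smooth_conjugation a one).1.
  rewrite conjugation1; apply: filterS => y yd.
  by rewrite /mul_rep /= /c !coordK // /conjugation mulgVK.
exact: etrans (esym (is_diffE d1 v)) (is_diffE (near_eq_is_diff nE (is_diff_comp dc d2)) v).
Qed.

Lemma diff_mul_rep_left1 w : 'd m0 (e0, e0) (w, 0) = w.
Proof.
have [U [oU Up] mS] := smooth_near_mul_rep one one; have [md _] := mS 1%N.
apply: etrans (esym (is_diffE (is_diff_slice_l (md _ Up)) w)) _.
have nE : \forall x \near e0, id x = m0 (x, e0).
  apply: filterS (nbhs_chart_img (mem_base_coord one)) => x xd.
  by rewrite /mul_rep /= pt_base_coord !mulg1 ptK.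
exact: (is_diffE (near_eq_is_diff nE (is_diff_id e0)) w).
Qed.

(** The difference between the values at x of the left-invariant and the
    right-invariant field with value v at 1. *)
Definition ad_defect v x := 'D_(0, v) m0 (x, e0) - 'D_(v, 0) m0 (e0, x).

(** The differential of x |-> 'D_(0, v) m (x, 1) along u is the mixed
    derivative 'D_(u, 0) 'D_(0, v) m at (1, 1), and that of x |-> 'D_(v, 0) m
    (1, x) is 'D_(0, u) 'D_(v, 0) m, which by symmetry is 'D_(v, 0) 'D_(0, u)
    m. The bracket [u, v] at 1 is the difference of the two. *)
Lemma is_diff_ad_defect v : is_diff e0 (ad_defect v)
  (fun u => lie_bracket (left_field u) (left_field v : G -> E) one).
Proof.
have [U [oU Up] mS] := smooth_near_mul_rep one one.
have [_ mD] := mS 2%N.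
have dD z : differentiable ('D_z m0) (e0, e0) by have [d _] := mD z; exact: d.
have dl z := is_diff_slice_l (dD z); have dr z := is_diff_slice_r (dD z).
have [h1 h2] := is_diffB (dl (0, v)) (dr (v, 0)).
split=> //; apply: etrans h2 _; apply/funext => u.
rewrite /lie_bracket !left_field1.
have D z w : 'd (field_in_chart one (left_field z)) e0 w = 'D_(w, 0) ('D_(0, z) m0) (e0, e0).
  (* At the point 1 the field with value z is x |-> 'D_(0, z) m0 (x, 1). *)
  have nE := near_left_field one z.
  have nE' : \forall x \near e0, 'D_(0, z) m0 (x, e0) = field_in_chart one (left_field z) x.
    by apply: filterS nE => x ->.
  apply: etrans (is_diffE (near_eq_is_diff nE' (dl (0, z))) w) _.
  by rewrite deriveE.
have S := schwarz (v, 0) (0, u) oU Up (mS 2%N).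
rewrite [X in _ = X - _]D [X in _ = _ - X]D.
rewrite [X in _ = _ - X]S.
by congr (_ - _); apply: esym; exact: deriveE.
Qed.

(** The differential of the right translation by x is close to the identity
    for x near 1, hence bounded below uniformly in w. This allows to divide
    by it without inverting it. *)
Lemma near_diff_mul_rep_le : \forall x \near e0,
  forall w, `|w| <= 2 * `|'d m0 (e0, x) (w, 0)|.
Proof.
have mS := smooth_near_mul_rep one one.
have nd : \forall x \near e0, differentiable m0 (e0, x).
  have [U [oU Up] fS] := mS; have [md _] := fS 1%N.
  have [d _] := is_diff_pair (is_diff_cst e0 e0) (is_diff_id e0).
  have c := differentiable_continuous d.
  have cU : \forall x \near e0, U (e0, x) := c _ (open_nbhs_nbhs (conj oU Up)).
  by apply: filterS cU => x; exact: md.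
(* The images of the n basis vectors, each moved by at most 1 / (2 (n + 1)),
   perturb w by at most |w| / 2. *)
pose C : R := 2 * n.+1%:R.
have C0 : 0 < C by rewrite mulr_gt0.
pose f i x := 'D_(delta_mx 0 i : E, 0 : E) m0 (e0, x).
have nf i : \forall x \near e0, `|f i e0 - f i x| <= C^-1.
  have [U [oU Up] fS] := smooth_near_slice_r (smooth_near_derive (delta_mx 0 i : E, 0 : E) mS).
  have := fS 0%N _ Up => /cvgrPdist_le; apply; by rewrite invr_gt0.
have nfa : \forall x \near e0, forall i, `|f i e0 - f i x| <= C^-1.
  exact: (@filter_forall E 'I_n (fun i x => `|f i e0 - f i x| <= C^-1) (nbhs e0) _ nf).
have f0 i : f i e0 = delta_mx 0 i.
  by rewrite /f deriveE ?diff_mul_rep_left1 //; exact: nbhs_singleton nd.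
apply: filterS2 nd nfa => x dx fx w.
pose L w := 'd m0 (e0, x) (w, 0).
have LE : L w = \sum_(i < n) w 0 i *: f i x.
  have dl := is_diff_slice_l dx.
  rewrite /L -(is_diffE dl) linear_row_sum; apply: eq_bigr => i _.
  by rewrite (is_diffE dl) /f deriveE.
have wE : w = \sum_(i < n) w 0 i *: f i e0.
  by rewrite {1}[w]row_sum_delta; apply: eq_bigr => i _; rewrite f0.
have h : `|w - L w| <= `|w| / 2.
  rewrite LE {1}wE -sumrB.
  apply: (le_trans (ler_norm_sum _ _ _)).
  apply: (@le_trans _ _ (\sum_(i < n) `|w| * C^-1)).
    apply: ler_sum => i _; rewrite -scalerBr normrZ ler_pM //.
    by rewrite [leRHS]/Num.Def.normr /= mx_normrE; exact: (le_bigmax _ _ (0, i)).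
  have Cn : C^-1 * n%:R <= 2^-1.
    by rewrite mulrC ler_pdivrMr // /C mulrA mulVf // mul1r ler_nat.
  by rewrite sumr_const card_ord -[leLHS]mulr_natr -mulrA ler_wpM2l.
have : `|w| <= `|w| / 2 + `|L w|.
  by rewrite -{1}(subrK (L w) w) (le_trans (ler_normD _ _)) // lerD2r.
rewrite /L; lra.
Qed.

(** Write A = Ad_x v - v. Then 'd m (1, x) (A, 0) is the defect of v at x,
    which is o(x - 1) as its value and its differential vanish at 1; the
    lower bound on 'd m (1, x) makes A itself o(x - 1). *)
Lemma is_diff_Ad1 v : (forall u, lie_bracket (left_field u) (left_field v : G -> E) one = 0) ->
  is_diff e0 (fun x => Ad (pt (chart_at one) x) v) 0.
Proof.
move=> br0; have [U [oU Up] mS] := smooth_near_mul_rep one one.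
have [md _] := mS 1%N.
have z0 : continuous (\0 : E -> E) by exact: cst_continuous.
suff [h1 h2] : is_diff e0 (fun x => Ad (pt (chart_at one) x) v) (\0 : {linear E -> E}).
  by split=> //; rewrite h2.
apply: is_diff_of_estimate => // eps eps0.
have [dd ddE] := is_diff_ad_defect v.
have eps20 : 0 < eps / 2 by rewrite divr_gt0.
have n1 := differentiable_estimate dd eps20.
have [dl _] := is_diff_pair (is_diff_id e0) (is_diff_cst e0 e0).
have [dr _] := is_diff_pair (is_diff_cst e0 e0) (is_diff_id e0).
have nl := differentiable_continuous dl (open_nbhs_nbhs (conj oU Up)).
have nr := differentiable_continuous dr (open_nbhs_nbhs (conj oU Up)).
have nI := nbhs_chart_img (mem_base_coord one).
have E0 : ad_defect v e0 = 0.
  rewrite /ad_defect !deriveE; try exact: md.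
  rewrite diff_mul_rep_Ad; try exact: md; last exact: mem_base_coord.
  by rewrite pt_base_coord Ad1 subrr.
near=> x.
have xI : chart_img one x by near: x.
have Ul : U (x, e0) by near: x.
have Ur : U (e0, x) by near: x.
rewrite pt_base_coord Ad1 subr0.
set A := Ad _ v - v.
have AE : 'd m0 (e0, x) (A, 0) = ad_defect v x.
  have D1 := deriveE (0, v) (md _ Ul); have D2 := deriveE (v, 0) (md _ Ur).
  have D3 := diff_mul_rep_Ad v xI (md _ Ul) (md _ Ur).
  have pE : (A, 0) = (Ad (pt (chart_at one) x) v, 0) - (v, 0) :> E * E.
    by congr (_, _); rewrite /= subr0.
  apply: etrans (congr1 ('d m0 (e0, x)) pE) (etrans (linearB _ _ _) _).
  rewrite /ad_defect; congr (_ - _); first exact: (esym (etrans D1 D3)).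
  exact: (esym D2).
have : `|A| <= 2 * `|ad_defect v x|.
  by rewrite -AE; move: A {AE}; near: x; exact: near_diff_mul_rep_le.
have : `|ad_defect v x| <= eps / 2 * `|x - e0|.
  have : `|ad_defect v x - ad_defect v e0 - 'd (ad_defect v) e0 (x - e0)|
    <= eps / 2 * `|x - e0| by near: x.
  by rewrite ddE br0 E0 !subr0.
lra.
Unshelve. all: by end_near. Qed.
End Adjoint.

(** * Groups with commuting left-invariant fields *)
Section Abelian.
Variables (R : realType) (n : nat) (G : lieGroupType R n).
Local Notation E := 'rV[R]_n.
Local Notation one := (1%g : G).
Implicit Types (a b p q : G) (u v w : E).

Lemma tangent0 (phi : G -> G) p : tangent phi p 0 = 0.
Proof. exact: linear0. Qed.

(** Ad_p = Ad_a Ad_(a^-1 p) reduces the differential at a to the one at 1. *)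
Lemma is_diff_Ad a v : (forall u v, lie_bracket (left_field u) (left_field v : G -> E) one = 0) ->
  is_diff (base_coord a) ((fun p => Ad p v) \o pt (chart_at a)) 0.
Proof.
move=> br0.
have dL := (smooth_map_differentiable a (smooth_mulgl (a^-1)%g)).
have La : (a^-1 * a)%g = one by rewrite mulVg.
have [Lc Ld] := dL.
pose l x := coord (chart_at one) (a^-1 * pt (chart_at a) x)%g.
have ld : is_diff (base_coord a) l ('d l (base_coord a)).
  by move: Ld; rewrite /local_rep La => Ld; exact: differentiableP.
have la : l (base_coord a) = base_coord one by rewrite /l pt_base_coord La.
have dA : is_diff (l (base_coord a)) (fun x => Ad (pt (chart_at one) x) v) 0.
  by rewrite la; exact: is_diff_Ad1.
have cAd : continuous (Ad a) := diff_continuous (smooth_conjugation a one).2.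
have dAa : is_diff (Ad (pt (chart_at one) (l (base_coord a))) v) (Ad a) (Ad a).
  by split; [exact: linear_differentiable|exact: diff_lin].
have h := is_diff_comp (is_diff_comp ld dA) dAa.
have nE : \forall x \near base_coord a,
    (Ad a \o ((fun x => Ad (pt (chart_at one) x) v) \o l)) x
    = ((fun p => Ad p v) \o pt (chart_at a)) x.
  have := nbhs_local_rep Lc; rewrite La; apply: filterS => x xd.
  by rewrite /= /l coordK // -Ad_mul mulVKg.
have [h1 h2] := near_eq_is_diff nE h.
by split=> //; apply: etrans h2 _; apply/funext => u /=; exact: linear0.
Qed.

Lemma Ad_trivial a v : connected [set: G] ->
  (forall u v, lie_bracket (left_field u) (left_field v : G -> E) one = 0) ->
  Ad a v = v.
Proof.
move=> Gc br0; apply: etrans _ (Ad1 G v).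
apply: (connected_locally_constant (f := fun p => Ad p v) Gc) => p.
apply: locally_constant_row; apply: nearW => q; exact: is_diff_Ad.
Qed.

Lemma is_diff_local_rep_mul (phi psi : G -> G) p :
  chart_differentiable phi p -> chart_differentiable psi p ->
  is_diff (base_coord p) (local_rep (fun q => (phi q * psi q)%g) p)
    (fun v => 'd (mul_rep (phi p) (psi p)) (base_coord (phi p), base_coord (psi p))
                (tangent phi p v, tangent psi p v)).
Proof.
move=> [phic dphi] [psic dpsi].
have [U [oU Up] mS] := smooth_near_mul_rep (phi p) (psi p).
have [/(_ _ Up) dm _] := mS 1%N.
have dm' : is_diff (local_rep phi p (base_coord p), local_rep psi p (base_coord p))
    (mul_rep (phi p) (psi p))
    ('d (mul_rep (phi p) (psi p)) (base_coord (phi p), base_coord (psi p))).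
  by rewrite !local_rep_base; exact: differentiableP.
have h := is_diff_comp (is_diff_pair (differentiableP dphi) (differentiableP dpsi)) dm'.
apply: near_eq_is_diff h.
apply: filterS2 (nbhs_local_rep phic) (nbhs_local_rep psic) => x xp xs.
by rewrite /mul_rep /local_rep /= !coordK.
Qed.

Lemma chart_differentiable_mul (phi psi : G -> G) p :
  chart_differentiable phi p -> chart_differentiable psi p ->
  chart_differentiable (fun q => (phi q * psi q)%g) p.
Proof.
move=> dphi dpsi; split; last by have [] := is_diff_local_rep_mul dphi dpsi.
apply: (@continuous_comp _ _ _ (fun q => (phi q, psi q)) (fun ab => (ab.1 * ab.2)%g)).
  by apply: cvg_pair; [exact: dphi.1|exact: dpsi.1].
exact: mulg_continuous.
Qed.

Lemma chart_differentiable_id p : chart_differentiable (fun q : G => q) p.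
Proof.
split; first exact: cvg_id.
exact: differentiable_transition (mem_chart_at p) (mem_chart_at p).
Qed.

Lemma tangent_cst (c : G) p v : tangent (fun _ : G => c) p v = 0.
Proof. exact: (congr1 (@^~ v) (diff_cst _ _)). Qed.

(** By the product rule the derivative of (a p a^-1) p^-1 at 1 depends on a
    only through Ad_a, so for Ad_a = id it agrees with that of p p^-1 = 1. *)
Lemma tangent_commutator1 a v : (forall w, Ad a w = w) ->
  tangent (fun p => conjugation a p * p^-1)%g one v = 0.
Proof.
move=> Aid.
have dc := smooth_conjugation a one; have di := chart_differentiable_id one.
have dV := smooth_map_differentiable one (@smooth_invg R n G).
apply: etrans (is_diffE (is_diff_local_rep_mul dc dV) v) _.
apply: etrans _ (tangent_cst one one v).
have -> : (fun _ : G => one) = (fun p => p * p^-1)%g by apply/funext => p; rewrite mulgV.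
apply: etrans _ (esym (is_diffE (is_diff_local_rep_mul di dV) v)).
rewrite conjugation1 tangent_id.
by rewrite -/(Ad a v) Aid.
Qed.

(** The commutator kappa p = a p a^-1 p^-1 satisfies kappa q = (a p a^-1)
    (kappa (p^-1 q)) p^-1, so that its differential at p factors through the
    one at 1, which is zero. *)
Lemma commute_of_Ad_trivial a b : connected [set: G] -> (forall w, Ad a w = w) ->
  conjugation a b = b.
Proof.
move=> Gc Aid; pose kappa p : G := (conjugation a p * p^-1)%g.
have dV p := smooth_map_differentiable p (@smooth_invg R n G).
have dk p : chart_differentiable kappa p.
  by apply: chart_differentiable_mul; [exact: smooth_conjugation|exact: dV].
have kE p : kappa = (fun q => conjugation a p * q)%g \o
    ((fun q => q * p^-1)%g \o (kappa \o (fun q => p^-1 * q)%g)).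
  apply/funext => q; rewrite /kappa /conjugation /=.
  by rewrite !invgM invgK !mulgA ?(mulgVK, mulgK).
have Tk p v : tangent kappa p v = 0.
  have dl q c := smooth_map_differentiable q (@smooth_mulgl R n G c).
  have dr q c := smooth_map_differentiable q (@smooth_mulgr R n G c).
  have d1 : chart_differentiable (kappa \o (fun q => p^-1 * q)%g) p.
    by apply: chart_differentiable_comp; [exact: dl|exact: dk].
  have d2 : chart_differentiable ((fun q => q * p^-1)%g \o (kappa \o (fun q => p^-1 * q)%g)) p.
    by apply: chart_differentiable_comp => //; exact: dr.
  rewrite (kE p) (tangent_comp v d2 (dl _ _)) (tangent_comp v d1 (dr _ _)).
  rewrite (tangent_comp v (dl _ _) (dk _)) mulVg tangent_commutator1 //.
  by rewrite !tangent0.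
have kc : continuous kappa by move=> p; exact: (dk p).1.
have lc p : \forall q \near p, kappa q = kappa p.
  apply: locally_constant_map => // q.
  by have [_ h] := dk q; split=> //; apply/funext => v; exact: Tk.
have := connected_locally_constant Gc lc b one.
rewrite /kappa conjugation1 mulgV => /(congr1 (fun x => x * b)%g).
by rewrite mulgVK mul1g.
Qed.

Theorem commutative_of_brackets0 : connected [set: G] ->
  (forall u v, lie_bracket (left_field u) (left_field v : G -> E) one = 0) ->
  forall a b : G, (a * b)%g = (b * a)%g.
Proof.
move=> Gc br0 a b.
have := commute_of_Ad_trivial b Gc (fun w => Ad_trivial a w Gc br0).
by rewrite /conjugation => {2}<-; rewrite mulgVK.
Qed.

End Abelian.

(** * Inner products and structure constants *)
Section InnerProduct.
Variables (R : realType) (n : nat) (g : 'rV[R]_n -> 'rV[R]_n -> R).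
Local Notation E := 'rV[R]_n.
Local Notation e i := (delta_mx 0 i : E).
Hypothesis g_linear : forall (a : R) u v w, g (a *: u + v) w = a * g u w + g v w.
Hypothesis g_sym : forall u v, g u v = g v u.
Hypothesis g_pos : forall u, u != 0 -> 0 < g u u.

Lemma form0l w : g 0 w = 0.
Proof.
have := g_linear 1 0 0 w; rewrite scaler0 addr0 mul1r => /eqP.
by rewrite -subr_eq subrr eq_sym => /eqP.
Qed.

Lemma formDl u v w : g (u + v) w = g u w + g v w.
Proof. by have := g_linear 1 u v w; rewrite scale1r mul1r. Qed.

Lemma formZl a u w : g (a *: u) w = a * g u w.
Proof. by have := g_linear a u 0 w; rewrite addr0 form0l addr0. Qed.

Lemma form_suml I (s : seq I) (F : I -> E) w : g (\sum_(i <- s) F i) w = \sum_(i <- s) g (F i) w.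
Proof.
elim: s => [|i s IH]; first by rewrite !big_nil form0l.
by rewrite !big_cons formDl IH.
Qed.

Lemma form_sumr I (s : seq I) (F : I -> E) w : g w (\sum_(i <- s) F i) = \sum_(i <- s) g w (F i).
Proof. by rewrite g_sym form_suml; apply: eq_bigr => i _; rewrite g_sym. Qed.

Lemma formZr a u w : g w (a *: u) = a * g w u.
Proof. by rewrite !(g_sym w) formZl. Qed.

Lemma formBl u v w : g (u - v) w = g u w - g v w.
Proof. by rewrite formDl -scaleN1r formZl mulN1r. Qed.

Lemma form_coords u w : g u w = \sum_(i < n) u 0 i * g (e i) w.
Proof. by rewrite {1}[u]row_sum_delta form_suml; apply: eq_bigr => i _; rewrite formZl. Qed.

(** The linear conditions g v (P i) = 0, i < k, have a nonzero solution as k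
    < n. *)
Lemma orthonormal_extend k (P : nat -> E) : (k < n)%N ->
  (forall i j, (i < k)%N -> (j < k)%N -> g (P i) (P j) = (i == j)%:R) ->
  exists2 v, g v v = 1 & forall i, (i < k)%N -> g v (P i) = 0.
Proof.
move=> kn PP; pose B : 'M[R]_(n, k) := \matrix_(i, j) g (e i) (P j).
have /rowV0Pn[v vK v0] : kermx B != 0.
  rewrite -mxrank_eq0 mxrank_ker subn_eq0 -ltnNge.
  exact: leq_ltn_trans (rank_leq_col B) kn.
have vB i : (i < k)%N -> g v (P i) = 0.
  move=> ik; have /sub_kermxP/matrixP/(_ 0 (Ordinal ik)) := vK.
  rewrite !mxE form_coords => h; rewrite -[RHS]h.
  by apply: eq_bigr => j _; rewrite !mxE.
have gv := g_pos v0; exists ((Num.sqrt (g v v))^-1 *: v) => [|i ik].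
  rewrite formZl formZr mulrA -expr2 exprVn sqr_sqrtr ?ltW //.
  by rewrite mulVf // gt_eqF.
by rewrite formZl vB // mulr0.
Qed.

Lemma orthonormal_basis : exists P : 'I_n -> E, forall i j, g (P i) (P j) = (i == j)%:R.
Proof.
suff [P PP] : exists P : nat -> E,
    forall i j, (i < n)%N -> (j < n)%N -> g (P i) (P j) = (i == j)%:R.
  by exists (fun i : 'I_n => P i) => i j; exact: PP.
suff H k : (k <= n)%N -> exists P : nat -> E,
    forall i j, (i < k)%N -> (j < k)%N -> g (P i) (P j) = (i == j)%:R.
  exact: H.
elim: k => [_|k IH kn]; first by exists (fun _ => 0).
have [P PP] := IH (ltnW kn); have [v vv vP] := orthonormal_extend kn PP.
exists (fun i => if i == k then v else P i) => i j; rewrite !ltnS => ik jk.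
have lt_k l : (l <= k)%N -> l != k -> (l < k)%N by move=> lk nl; rewrite ltn_neqAle nl.
have [ei|ni] := boolP (i == k); have [ej|nj] := boolP (j == k).
- by rewrite (eqP ei) (eqP ej) eqxx.
- by rewrite vP ?lt_k // (eqP ei) eq_sym (negPf nj).
- by rewrite g_sym vP ?lt_k // (eqP ej) (negPf ni).
- by apply: PP; exact: lt_k.
Qed.

Section Orthonormal.
Variable P : 'I_n -> E.
Hypothesis PP : forall i j, g (P i) (P j) = (i == j)%:R.

Lemma orthonormal_expand v : v = \sum_(i < n) g v (P i) *: P i.
Proof.
pose A : 'M[R]_n := \matrix_(i, j) P i 0 j.
pose B : 'M[R]_n := \matrix_(i, j) g (e i) (P j).
have AB : A *m B = 1%:M.
  apply/matrixP => i j; rewrite !mxE -PP form_coords.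
  by apply: eq_bigr => k _; rewrite !mxE.
have BA := mulmx1C AB.
have {1}-> : v = (v *m B) *m A by rewrite -mulmxA BA mulmx1.
apply/rowP => j; rewrite mxE summxE; apply: eq_bigr => i _.
by rewrite !mxE form_coords; congr (_ * _); apply: eq_bigr => k _; rewrite !mxE.
Qed.

Lemma form_orthonormal u v : g u v = \sum_(i < n) g u (P i) * g v (P i).
Proof.
rewrite {1}(orthonormal_expand v) form_sumr; apply: eq_bigr => i _.
by rewrite formZr mulrC.
Qed.

Lemma orthonormal_row_free i j : i != j -> row_free (col_mx (P i) (P j)).
Proof.
move=> ij; apply/row_freeP; exists (row_mx (\col_k g (e k) (P i)) (\col_k g (e k) (P j))).
have E k l : P k *m (\col_m g (e m) (P l)) = (k == l)%:R%:M.
  apply/matrixP => a b; rewrite !mxE !ord1 eqxx mulr1n -PP form_coords.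
  by apply: eq_bigr => m _; rewrite !mxE.
rewrite mul_col_row !E !eqxx (eq_sym j) (negPf ij) /= scalar_mx_block.
by congr block_mx; apply/matrixP => a b; rewrite !mxE ?mul0rn.
Qed.

(** The trace of phi computed in an orthonormal basis. The hypothesis on phi
    is the form of linearity in which the curvature tensor is known. *)
Lemma trace_orthonormal (phi : E -> E) :
  (forall u, phi u = \sum_(l < n) g u (P l) *: phi (P l)) ->
  \sum_(i < n) phi (e i) 0 i = \sum_(l < n) g (phi (P l)) (P l).
Proof.
move=> phiE.
transitivity (\sum_(i < n) \sum_(l < n) g (e i) (P l) * phi (P l) 0 i).
  by apply: eq_bigr => i _; rewrite phiE summxE; apply: eq_bigr => l _; rewrite mxE.
rewrite exchange_big /=; apply: eq_bigr => l _; rewrite form_coords.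
by apply: eq_bigr => i _; rewrite mulrC.
Qed.

(** With A the matrix of rows P k, orthonormality reads A G A^T = 1, so the
    inverse Gram matrix is A^T A. *)
Lemma gram_trace_orthonormal (r : E -> E -> R) :
  (forall u v, r u v = \sum_(i < n) \sum_(j < n) u 0 i * v 0 j * r (e i) (e j)) ->
  \sum_(i < n) \sum_(j < n) invmx (\matrix_(i, j) g (e i) (e j)) i j * r (e i) (e j)
  = \sum_(k < n) r (P k) (P k).
Proof.
move=> rE; set Gm := (\matrix_(i, j) _).
pose A : 'M[R]_n := \matrix_(i, j) P i 0 j.
have AGA : A *m (Gm *m A^T) = 1%:M.
  apply/matrixP => i j; rewrite !mxE -PP form_coords; apply: eq_bigr => k _.
  rewrite !mxE g_sym form_coords; congr (_ * _); apply: eq_bigr => l _.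
  by rewrite !mxE g_sym mulrC.
have h : Gm *m (A^T *m A) = 1%:M by rewrite mulmxA; exact: mulmx1C.
have -> : invmx Gm = A^T *m A.
  have [Gu _] := mulmx1_unit h.
  by rewrite -[LHS]mulmx1 -h mulKmx.
transitivity (\sum_(i < n) \sum_(j < n) \sum_(k < n) P k 0 i * P k 0 j * r (e i) (e j)).
  apply: eq_bigr => i _; apply: eq_bigr => j _; rewrite !mxE mulr_suml.
  by apply: eq_bigr => k _; rewrite !mxE.
under eq_bigr do rewrite exchange_big /=.
rewrite exchange_big /=; apply: eq_bigr => k _; by rewrite rE.
Qed.

End Orthonormal.
End InnerProduct.

(** Let A = sum c_ijk^2 and B = sum c_ijk c_jki. Summing the squares of the
    cyclic identity gives 3 A + 6 B = 0. By antisymmetry the middle term on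
    the left sums to - B = A / 2, which leaves A / 2 - A. *)
Lemma sum_structure_constants (R : realType) n (c : 'I_n -> 'I_n -> 'I_n -> R) :
  (forall i j k, c j i k = - c i j k) ->
  (forall i j k, c i j k + c j k i + c k i j = 0) ->
  \sum_i \sum_j (- (\sum_k c k j j * c k i i) + (\sum_k c k j i * c k i j)
                  - \sum_k c i j k ^+ 2)
  = - (\sum_k (\sum_i c k i i) ^+ 2) - (\sum_i \sum_j \sum_k c i j k ^+ 2) / 2.
Proof.
move=> anti cyc.
pose A := \sum_i \sum_j \sum_k c i j k ^+ 2.
pose B := \sum_i \sum_j \sum_k c i j k * c j k i.
(* Cyclic relabelling of the three summation indices. *)
pose rot (F : 'I_n -> 'I_n -> 'I_n -> R) := \sum_i \sum_j \sum_k F j k i.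
have rotE F : \sum_i \sum_j \sum_k F i j k = rot F.
  rewrite /rot [RHS]exchange_big /=; apply: eq_bigr => i _.
  by rewrite exchange_big.
have AB : 3 * A + 6 * B = 0.
  have A1 : A = \sum_i \sum_j \sum_k c j k i ^+ 2.
    by rewrite [LHS](rotE (fun i j k => c i j k ^+ 2)).
  have A2 : A = \sum_i \sum_j \sum_k c k i j ^+ 2.
    by rewrite A1 [LHS](rotE (fun i j k => c j k i ^+ 2)).
  have B1 : B = \sum_i \sum_j \sum_k c j k i * c k i j.
    by rewrite [LHS](rotE (fun i j k => c i j k * c j k i)).
  have B2 : B = \sum_i \sum_j \sum_k c k i j * c i j k.
    by rewrite B1 [LHS](rotE (fun i j k => c j k i * c k i j)).
  have : \sum_i \sum_j \sum_k (c i j k + c j k i + c k i j) ^+ 2 = 0 :> R.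
    by rewrite big1 // => i _; rewrite big1 // => j _; rewrite big1 // => k _; rewrite cyc expr0n.
  have -> : \sum_i \sum_j \sum_k (c i j k + c j k i + c k i j) ^+ 2 =
    A + (\sum_i \sum_j \sum_k c j k i ^+ 2) + (\sum_i \sum_j \sum_k c k i j ^+ 2)
    + 2 * (B + (\sum_i \sum_j \sum_k c j k i * c k i j) + (\sum_i \sum_j \sum_k c k i j * c i j k)).
    rewrite /A /B -!big_split /= mulr_sumr -big_split /=; apply: eq_bigr => i _.
    rewrite -!big_split /= mulr_sumr -big_split /=; apply: eq_bigr => j _.
    rewrite -!big_split /= mulr_sumr -big_split /=; apply: eq_bigr => k _; ring.
  rewrite -A1 -A2 -B1 -B2; lra.
have S1 : \sum_i \sum_j \sum_k c k j j * c k i i = \sum_k (\sum_i c k i i) ^+ 2.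
  transitivity (\sum_i \sum_k \sum_j c k j j * c k i i).
    by apply: eq_bigr => i _; rewrite exchange_big.
  rewrite exchange_big /=; apply: eq_bigr => k _.
  by rewrite expr2 mulr_sumr; apply: eq_bigr => i _; rewrite mulr_suml.
have S2 : \sum_i \sum_j \sum_k c k j i * c k i j = - B.
  rewrite /B (rotE (fun i j k => c i j k * c j k i)) /rot -sumrN; apply: eq_bigr => i _.
  rewrite -sumrN; apply: eq_bigr => j _; rewrite -sumrN; apply: eq_bigr => k _.
  by rewrite (anti j k i) mulNr.
transitivity (- (\sum_i \sum_j \sum_k c k j j * c k i i)
   + (\sum_i \sum_j \sum_k c k j i * c k i j) - A).
  rewrite /A -!sumrN -!big_split /=; apply: eq_bigr => i _.
  by rewrite -!sumrN -!big_split.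
rewrite S1 S2 -/A; lra.
Qed.

(** * Tensoriality of the curvature *)
Section Curvature.
Variables (R : realType) (n : nat) (M : manifoldType R n).
Local Notation E := 'rV[R]_n.
Local Notation VF := (M -> E).
Variables (h : M -> E -> E -> R) (nabla : VF -> VF -> VF).
Hypothesis hR : riemannian_metric h.
Hypothesis LC : levi_civita h nabla.
Implicit Types (X Y Z W : VF) (f : M -> R) (p : M).

Local Ltac row_ring p :=
  repeat match goal with
  | |- context [nabla ?X ?Y p] => generalize (nabla X Y p)
  | |- context [field_deriv ?X ?f p] => generalize (field_deriv X f p)
  end; intros; apply/rowP => ?; rewrite !mxE; ring.

Definition lincomb f X Y : VF := fun q => f q *: X q + Y q.

Lemma smooth_lincomb f X Y : smooth_fun f -> smooth_field X -> smooth_field Y ->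
  smooth_field (lincomb f X Y).
Proof. by move=> fS XS YS; apply: smooth_fieldD => //; exact: smooth_fieldZ. Qed.

Lemma smooth_field0 : smooth_field (fun _ : M => 0 : E).
Proof.
move=> p k; have -> : field_in_chart p (fun _ : M => 0 : E) = cst 0.
  by apply/funext => x; rewrite /field_in_chart linear0.
exact: Ck_on_cst.
Qed.

Lemma smooth_nabla X Y : smooth_field X -> smooth_field Y -> smooth_field (nabla X Y).
Proof. exact: nabla_smooth LC _ _. Qed.

(** Torsion-freeness expresses the bracket by the connection; the Leibniz
    rules of the bracket then follow from those of nabla, without charts. *)
Lemma lie_bracketE X Y : smooth_field X -> smooth_field Y ->
  lie_bracket X Y = fun p => nabla X Y p - nabla Y X p.
Proof. by move=> XS YS; apply/funext => p; rewrite (nabla_torsion_free LC). Qed.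

Lemma smooth_bracket X Y : smooth_field X -> smooth_field Y -> smooth_field (lie_bracket X Y).
Proof.
move=> XS YS; rewrite lie_bracketE //.
have := smooth_lincomb (@smooth_fun_cst _ _ M (-1)) (smooth_nabla YS XS) (smooth_nabla XS YS).
by congr smooth_field; apply/funext => p; rewrite /lincomb scaleN1r addrC.
Qed.

Lemma nabla_lincombl f X Y Z : smooth_fun f ->
  smooth_field X -> smooth_field Y -> smooth_field Z ->
  nabla (lincomb f X Y) Z = lincomb f (nabla X Z) (nabla Y Z).
Proof. by move=> fS XS YS ZS; apply/funext => p; exact: nabla_linear LC _ _ _ _ fS XS YS ZS p. Qed.

Lemma nabla_lincombr f X Y Z : smooth_fun f ->
  smooth_field X -> smooth_field Y -> smooth_field Z ->
  nabla X (lincomb f Y Z) =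
  lincomb (field_deriv X f) Y (lincomb f (nabla X Y) (nabla X Z)).
Proof.
move=> fS XS YS ZS; apply/funext => p.
rewrite /lincomb (nabla_additive LC) //; last exact: smooth_fieldZ.
by rewrite (nabla_leibniz LC) // addrA.
Qed.

Lemma lie_bracket_lincombl f X X' Y : smooth_fun f ->
  smooth_field X -> smooth_field X' -> smooth_field Y ->
  lie_bracket (lincomb f X X') Y =
  lincomb f (lie_bracket X Y)
    (lincomb (fun p => - field_deriv Y f p) X (lie_bracket X' Y)).
Proof.
move=> fS XS XS' YS; have WS := smooth_lincomb fS XS XS'.
rewrite !lie_bracketE // nabla_lincombl // nabla_lincombr //.
by apply/funext => p; rewrite /lincomb; row_ring p.
Qed.

(** The derivative of f appears twice, from differentiating f *: nabla X Z
    along Y and from [f X, Y] = f [X, Y] - (Y f) X, with opposite signs. *)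
Lemma riemann_field_lincomb1 f X X' Y Z p : smooth_fun f ->
  smooth_field X -> smooth_field X' -> smooth_field Y -> smooth_field Z ->
  riemann_field nabla (lincomb f X X') Y Z p =
  f p *: riemann_field nabla X Y Z p + riemann_field nabla X' Y Z p.
Proof.
move=> fS XS XS' YS ZS; have YfS := smooth_field_deriv fS YS.
have NfS : smooth_fun (fun p => - field_deriv Y f p).
  move=> q k; have oI : open (chart_img q) by exact: open_img.
  apply: eq_Ck_on oI _ (Ck_on_scale oI (Ck_on_cst (chart_img q) k (-1 : R)) (YfS q k)).
  by move=> x _; rewrite /= [LHS]mulN1r.
have YZ := smooth_nabla YS ZS; have XZ := smooth_nabla XS ZS.
have XZ' := smooth_nabla XS' ZS.
rewrite /riemann_field lie_bracket_lincombl // !nabla_lincombl //.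
- by rewrite nabla_lincombr // /lincomb; row_ring p.
- exact: smooth_bracket.
- exact: smooth_bracket.
- by apply: smooth_lincomb => //; exact: smooth_bracket.
Qed.

Lemma lie_bracket_anti X Y : smooth_field X -> smooth_field Y ->
  lie_bracket X Y = lincomb (fun _ => -1) (lie_bracket Y X) (fun _ => 0).
Proof.
move=> XS YS; rewrite !lie_bracketE //.
by apply/funext => p; rewrite /lincomb; row_ring p.
Qed.

Lemma nabla0l Z : smooth_field Z -> nabla (fun _ => 0) Z = fun _ => 0.
Proof.
move=> ZS; have S0 := smooth_field0.
have := nabla_lincombl (@smooth_fun_cst _ _ M 1) S0 S0 ZS.
have -> : lincomb (fun _ => 1) (fun _ : M => 0 : E) (fun _ => 0) = fun _ => 0.
  by apply/funext => q; rewrite /lincomb scaler0 addr0.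
move=> E0; apply/funext => p; have := congr1 (@^~ p) E0; rewrite /lincomb scale1r.
by move=> /eqP; rewrite -subr_eq subrr eq_sym => /eqP.
Qed.

Lemma riemann_field_anti X Y Z p : smooth_field X -> smooth_field Y -> smooth_field Z ->
  riemann_field nabla X Y Z p = - riemann_field nabla Y X Z p.
Proof.
move=> XS YS ZS; rewrite /riemann_field (lie_bracket_anti XS YS).
rewrite nabla_lincombl //; [|exact: smooth_fun_cst|exact: smooth_bracket|exact: smooth_field0].
by rewrite nabla0l // /lincomb; row_ring p.
Qed.

Lemma riemann_field_lincomb2 f X Y Y' Z p : smooth_fun f ->
  smooth_field X -> smooth_field Y -> smooth_field Y' -> smooth_field Z ->
  riemann_field nabla X (lincomb f Y Y') Z p =
  f p *: riemann_field nabla X Y Z p + riemann_field nabla X Y' Z p.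
Proof.
move=> fS XS YS YS' ZS; have WS := smooth_lincomb fS YS YS'.
rewrite (riemann_field_anti _ XS WS ZS) riemann_field_lincomb1 //.
rewrite opprD -scalerN.
by congr (_ *: _ + _); apply: esym; exact: riemann_field_anti.
Qed.

(** The second derivatives of f contribute X (Y f) - Y (X f) - [X, Y] f = 0. *)
Lemma riemann_field_lincomb3 f X Y Z Z' p : smooth_fun f ->
  smooth_field X -> smooth_field Y -> smooth_field Z -> smooth_field Z' ->
  riemann_field nabla X Y (lincomb f Z Z') p =
  f p *: riemann_field nabla X Y Z p + riemann_field nabla X Y Z' p.
Proof.
move=> fS XS YS ZS ZS'; have YfS := smooth_field_deriv fS YS.
have XfS := smooth_field_deriv fS XS; have BS := smooth_bracket XS YS.
have YZ := smooth_nabla YS ZS; have XZ := smooth_nabla XS ZS.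
have YZ' := smooth_nabla YS ZS'; have XZ' := smooth_nabla XS ZS'.
have s1 := smooth_lincomb fS YZ YZ'; have s2 := smooth_lincomb fS XZ XZ'.
rewrite /riemann_field !(nabla_lincombr fS) //.
rewrite (nabla_lincombr YfS XS ZS s1) (nabla_lincombr XfS YS ZS s2).
rewrite (nabla_lincombr fS XS YZ YZ') (nabla_lincombr fS YS XZ XZ').
rewrite /lincomb (field_deriv_bracket _ XS YS fS).
row_ring p.
Qed.

Section Frame.
Variable F : 'I_n -> VF.
Hypothesis FS : forall i, smooth_field (F i).
Hypothesis FF : forall p i j, h p (F i p) (F j p) = (i == j)%:R.

Lemma smooth_frame_sum (s : seq 'I_n) (a : 'I_n -> M -> R) : (forall i, smooth_fun (a i)) ->
  smooth_field (fun q => \sum_(i <- s) a i q *: F i q).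
Proof.
move=> aS; elim: s => [|i s IH].
  by under eq_fun do rewrite big_nil; exact: smooth_field0.
by under eq_fun do rewrite big_cons; exact: smooth_lincomb.
Qed.

(** T may be linear over all smooth functions, with c the evaluation at a
    point, or only over the constants, as the Lie bracket with a fixed field
    is. *)
Lemma operator_frame_sum (A : (M -> R) -> Prop) (T : VF -> E) (c : (M -> R) -> R)
    (s : seq 'I_n) (a : 'I_n -> M -> R) :
  (forall f, A f -> smooth_fun f) -> A (fun _ => 1) -> c (fun _ => 1) = 1 ->
  (forall f X Y, A f -> smooth_field X -> smooth_field Y ->
     T (lincomb f X Y) = c f *: T X + T Y) ->
  (forall i, A (a i)) ->
  T (fun q => \sum_(i <- s) a i q *: F i q) = \sum_(i <- s) c (a i) *: T (F i).
Proof.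
move=> AS A1 c1 TL aA; elim: s => [|i s IH].
  under eq_fun do rewrite big_nil; rewrite big_nil.
  have := TL _ _ _ A1 smooth_field0 smooth_field0.
  have -> : lincomb (fun _ => 1) (fun _ : M => 0 : E) (fun _ => 0) = fun _ => 0.
    by apply/funext => q; rewrite /lincomb scaler0 addr0.
  by rewrite c1 scale1r => /eqP; rewrite -subr_eq subrr eq_sym => /eqP.
under eq_fun do rewrite big_cons; rewrite big_cons -IH.
by apply: TL => //; apply: smooth_frame_sum => j; exact: AS.
Qed.

Lemma field_expand X : X = fun q => \sum_(i < n) h q (X q) (F i q) *: F i q.
Proof.
apply/funext => q; apply: orthonormal_expand (FF q) _.
by move=> ? ? ? ?; exact: metric_linear.
Qed.

Lemma tensorial_expand (T : VF -> E) p X :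
  (forall f X Y, smooth_fun f -> smooth_field X -> smooth_field Y ->
     T (lincomb f X Y) = f p *: T X + T Y) ->
  smooth_field X -> T X = \sum_(i < n) h p (X p) (F i p) *: T (F i).
Proof.
move=> TL XS; rewrite {1}(field_expand X).
apply: (@operator_frame_sum (@smooth_fun R n M) T (@^~ p)) => //.
  exact: smooth_fun_cst.
by move=> i; exact: metric_smooth.
Qed.

Lemma riemann_field_expand X Y Z p : smooth_field X -> smooth_field Y -> smooth_field Z ->
  riemann_field nabla X Y Z p =
  \sum_(i < n) h p (X p) (F i p) *: \sum_(j < n) h p (Y p) (F j p) *:
    \sum_(k < n) h p (Z p) (F k p) *: riemann_field nabla (F i) (F j) (F k) p.
Proof.
move=> XS YS ZS.
rewrite (tensorial_expand (p := p) (T := fun X => riemann_field nabla X Y Z p) _ XS); last first.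
  by move=> *; exact: riemann_field_lincomb1.
apply: eq_bigr => i _; congr (_ *: _).
rewrite (tensorial_expand (p := p) (T := fun Y => riemann_field nabla (F i) Y Z p) _ YS); last first.
  by move=> *; exact: riemann_field_lincomb2.
apply: eq_bigr => j _; congr (_ *: _).
rewrite (tensorial_expand (p := p) (T := fun Z => riemann_field nabla (F i) (F j) Z p) _ ZS) //.
by move=> *; exact: riemann_field_lincomb3.
Qed.

Lemma smooth_extension p u : exists2 X : VF, smooth_field X & X p = u.
Proof.
exists (fun q => \sum_(i < n) h p u (F i p) *: F i q).
  by apply: (smooth_frame_sum _ (a := fun i _ => h p u (F i p))) => i; exact: smooth_fun_cst.
apply: esym; apply: orthonormal_expand (FF p) u.
by move=> ? ? ? ?; exact: metric_linear.
Qed.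

(** The point of this expansion is that its right-hand side involves u, v and
    w only: whichever extensions are selected in the definition of the
    curvature tensor, they give this value, and frame combinations with
    constant coefficients show that extensions exist. *)
Lemma riemannE p u v w : riemann nabla p u v w =
  \sum_(i < n) h p u (F i p) *: \sum_(j < n) h p v (F j p) *:
    \sum_(k < n) h p w (F k p) *: riemann_field nabla (F i) (F j) (F k) p.
Proof.
rewrite /riemann; case: xgetP => [z _ [X [Y [Z [[XS YS ZS] [Xp Yp Zp <-]]]]]|none].
  by rewrite riemann_field_expand // Xp Yp Zp.
have [X XS Xp] := smooth_extension p u; have [Y YS Yp] := smooth_extension p v.
have [Z ZS Zp] := smooth_extension p w.
by have [] := none (riemann_field nabla X Y Z p); exists X, Y, Z.
Qed.

End Frame.
End Curvature.

(** * Curvature in an orthonormal frame *)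
Section FrameCurvature.
Variables (R : realType) (n : nat) (M : manifoldType R n).
Local Notation E := 'rV[R]_n.
Local Notation VF := (M -> E).
Variables (h : M -> E -> E -> R) (nabla : VF -> VF -> VF).
Hypothesis hR : riemannian_metric h.
Hypothesis LC : levi_civita h nabla.
Variable F : 'I_n -> VF.
Hypothesis FS : forall i, smooth_field (F i).
Hypothesis FF : forall p i j, h p (F i p) (F j p) = (i == j)%:R.

Let hl p (a : R) u v w : h p (a *: u + v) w = a * h p u w + h p v w := metric_linear hR p a u v w.
Let hs p u v : h p u v = h p v u := metric_sym hR p u v.

Lemma sum_orthonormal p (a : 'I_n) (T : 'I_n -> E) :
  \sum_(i < n) h p (F a p) (F i p) *: T i = T a.
Proof.
rewrite (bigD1 a) //= FF eqxx scale1r big1 ?addr0 // => i ia.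
by rewrite FF eq_sym (negPf ia) scale0r.
Qed.

Lemma riemann_frame p i j k :
  riemann nabla p (F i p) (F j p) (F k p) = riemann_field nabla (F i) (F j) (F k) p.
Proof. by rewrite (riemannE hR LC FS FF) !sum_orthonormal. Qed.

Lemma ricci_frame p u v :
  ricci nabla p u v = \sum_(l < n) h p (riemann nabla p (F l p) u v) (F l p).
Proof.
apply: (trace_orthonormal (hl p) (P := fun l => F l p) (phi := fun w => riemann nabla p w u v)) => w.
rewrite {1}(riemannE hR LC FS FF); apply: eq_bigr => l _; congr (_ *: _).
by rewrite (riemannE hR LC FS FF) sum_orthonormal.
Qed.

Lemma ricci_coords p u v : ricci nabla p u v =
  \sum_(i < n) \sum_(j < n) u 0 i * v 0 j * ricci nabla p (delta_mx 0 i) (delta_mx 0 j).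
Proof.
pose S j k := \sum_(l < n) h p (riemann_field nabla (F l) (F j) (F k) p) (F l p).
have rE x y : ricci nabla p x y =
    \sum_(j < n) \sum_(k < n) h p x (F j p) * (h p y (F k p) * S j k).
  rewrite ricci_frame.
  transitivity (\sum_(l < n) \sum_(j < n) \sum_(k < n) h p x (F j p) *
     (h p y (F k p) * h p (riemann_field nabla (F l) (F j) (F k) p) (F l p))).
    apply: eq_bigr => l _; rewrite (riemannE hR LC FS FF) sum_orthonormal.
    rewrite (form_suml (hl p)); apply: eq_bigr => j _.
    rewrite (formZl (hl p)) (form_suml (hl p)) mulr_sumr; apply: eq_bigr => k _.
    by rewrite (formZl (hl p)).
  rewrite exchange_big /=; apply: eq_bigr => j _.
  rewrite exchange_big /=; apply: eq_bigr => k _.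
  by rewrite !mulr_sumr.
rewrite rE.
transitivity (\sum_(j < n) \sum_(k < n) \sum_(a < n) \sum_(b < n) u 0 a * v 0 b *
   (h p (delta_mx 0 a) (F j p) * (h p (delta_mx 0 b) (F k p) * S j k))).
  apply: eq_bigr => j _; apply: eq_bigr => k _.
  rewrite (form_coords (hl p) u) (form_coords (hl p) v) mulr_suml; apply: eq_bigr => a _.
  by rewrite mulr_suml mulr_sumr; apply: eq_bigr => b _; ring.
under eq_bigr do rewrite exchange_big /=.
rewrite exchange_big /=; apply: eq_bigr => a _.
under eq_bigr do rewrite exchange_big /=.
rewrite exchange_big /=; apply: eq_bigr => b _.
by rewrite rE mulr_sumr; apply: eq_bigr => j _; rewrite mulr_sumr.
Qed.

Lemma scalar_curvature_ricci p :
  scalar_curvature h nabla p = \sum_(k < n) ricci nabla p (F k p) (F k p).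
Proof.
exact: (gram_trace_orthonormal (hl p) (hs p) (FF p) (r := ricci nabla p) (ricci_coords p)).
Qed.

Lemma sectional_frame p i j : i != j -> sectional_curvature h nabla p (F i p) (F j p)
  = h p (riemann nabla p (F i p) (F j p) (F j p)) (F i p).
Proof.
move=> ij; rewrite /sectional_curvature !FF !eqxx (negPf ij).
by rewrite mulr1 expr0n subr0 divr1.
Qed.

(** In the orthonormal frame, the scalar curvature is the sum of the
    sectional curvatures of the pairs (i, j) with i != j; the terms with i =
    j vanish by antisymmetry. *)
Lemma scalar_curvature_ge0_of_sectional p :
  positive_sectional_curvature h nabla -> 0 <= scalar_curvature h nabla p.
Proof.
move=> sec; rewrite scalar_curvature_ricci sumr_ge0 // => j _.
rewrite ricci_frame sumr_ge0 // => i _; have [->|ij] := eqVneq i j.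
  have E0 : riemann nabla p (F j p) (F j p) (F j p) = 0.
    rewrite riemann_frame; have := riemann_field_anti LC p (FS j) (FS j) (FS j).
    move=> /eqP; rewrite -addr_eq0 -mulr2n -scaler_nat scaler_eq0 pnatr_eq0 /=.
    by move=> /eqP.
  by rewrite E0 (form0l (hl p)).
rewrite -sectional_frame // ltW //; apply: sec.
exact: (orthonormal_row_free (hl p) (FF p)).
Qed.

Lemma frame_neq0 p i : F i p != 0.
Proof.
apply/eqP => Fi0; have := FF p i i; rewrite eqxx Fi0 (form0l (hl p)) => /eqP.
by rewrite eq_sym oner_eq0.
Qed.

Lemma scalar_curvature_ge0_of_ricci p :
  positive_ricci_curvature nabla -> 0 <= scalar_curvature h nabla p.
Proof.
move=> ric; rewrite scalar_curvature_ricci sumr_ge0 // => j _.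
by rewrite ltW //; apply: ric; exact: frame_neq0.
Qed.

Variable c : 'I_n -> 'I_n -> 'I_n -> R.
Hypothesis cE : forall p i j k, h p (lie_bracket (F i) (F j) p) (F k p) = c i j k.
Hypothesis c_cyclic : forall i j k, c i j k + c j k i + c k i j = 0.

Lemma structure_anti (p : M) i j k : c j i k = - c i j k.
Proof.
by rewrite -!(cE p) !(lie_bracketE LC) // !(formBl (hl p)) opprB.
Qed.

Lemma bracket_frame i j :
  lie_bracket (F i) (F j) = fun p => \sum_(k < n) c i j k *: F k p.
Proof.
rewrite (field_expand hR FF (lie_bracket (F i) (F j))).
by apply/funext => p; apply: eq_bigr => k _; rewrite cE.
Qed.

(** The Koszul formula 2 h(nabla_(E_i) E_j, E_k) = c_ijk - c_jki + c_kij; the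
    cyclic identity turns its right-hand side into - 2 c_jki = 2 c_kji. It is
    obtained by solving the six equations given by torsion-freeness and by
    compatibility with the constant metric coefficients. *)
Lemma christoffel p i j k : h p (nabla (F i) (F j) p) (F k p) = c k j i.
Proof.
have T a b d : h p (nabla (F a) (F b) p) (F d p) - h p (nabla (F b) (F a) p) (F d p) = c a b d.
  by rewrite -(cE p) (lie_bracketE LC) // (formBl (hl p)).
have C a b d : h p (nabla (F a) (F b) p) (F d p) + h p (nabla (F a) (F d) p) (F b p) = 0.
  rewrite [X in _ + X]hs -(nabla_metric LC) //.
  have -> : (fun q => h q (F b q) (F d q)) = fun _ => (b == d)%:R by apply/funext => q.
  exact: field_deriv_cst.
have := structure_anti p j k i; have := c_cyclic i j k.
have := T i j k; have := T j k i; have := T k i j.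
have := C i j k; have := C j k i; have := C k i j.
lra.
Qed.

(** Metric compatibility moves the outer derivative: h(nabla_a nabla_b E_d,
    E_e) = - h(nabla_b E_d, nabla_a E_e), as h(nabla_b E_d, E_e) is constant. *)
Lemma curvature_frame p i j :
  h p (riemann_field nabla (F i) (F j) (F j) p) (F i p)
  = - (\sum_k c k j j * c k i i) + (\sum_k c k j i * c k i j) - \sum_k c i j k ^+ 2.
Proof.
have nS a b : smooth_field (nabla (F a) (F b)) by exact: (smooth_nabla LC (FS a) (FS b)).
have D a b d e : h p (nabla (F a) (nabla (F b) (F d)) p) (F e p)
    = - \sum_k c k d b * c k e a.
  apply/eqP; rewrite -addr_eq0.
  have -> : \sum_k c k d b * c k e a = h p (nabla (F b) (F d) p) (nabla (F a) (F e) p).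
    rewrite (form_orthonormal (hl p) (hs p) (FF p)).
    by apply: eq_bigr => k _; rewrite !christoffel.
  rewrite -(nabla_metric LC) //.
  have -> : (fun q => h q (nabla (F b) (F d) q) (F e q)) = fun _ => c e d b.
    by apply/funext => q; rewrite christoffel.
  by rewrite field_deriv_cst.
have B : h p (nabla (lie_bracket (F i) (F j)) (F j) p) (F i p) = \sum_k c i j k ^+ 2.
  rewrite (tensorial_expand hR FS FF (p := p) (T := fun X => nabla X (F j) p)).
  - rewrite (form_suml (hl p)); apply: eq_bigr => k _.
    by rewrite (formZl (hl p)) cE christoffel expr2.
  - by move=> f X Y fS XS YS; rewrite (nabla_lincombl LC).
  - exact: smooth_bracket LC _ _ (FS i) (FS j).
rewrite /riemann_field !(formBl (hl p)) !D B opprK; congr (_ + _ - _).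
Qed.

Lemma scalar_curvature_structure p : scalar_curvature h nabla p =
  - (\sum_k (\sum_i c k i i) ^+ 2) - (\sum_i \sum_j \sum_k c i j k ^+ 2) / 2.
Proof.
rewrite -(sum_structure_constants (structure_anti p) c_cyclic).
rewrite scalar_curvature_ricci [RHS]exchange_big /=; apply: eq_bigr => j _.
rewrite ricci_frame; apply: eq_bigr => i _.
by rewrite riemann_frame curvature_frame.
Qed.

Lemma scalar_curvature_lt0 p : (exists i j k, c i j k != 0) -> scalar_curvature h nabla p < 0.
Proof.
case=> i [j [k cn0]]; rewrite scalar_curvature_structure.
have H0 : 0 <= \sum_k (\sum_i c k i i) ^+ 2 by apply: sumr_ge0 => l _; exact: sqr_ge0.
have s0 a b : 0 <= \sum_k c a b k ^+ 2 by apply: sumr_ge0 => l _; exact: sqr_ge0.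
have s1 a : 0 <= \sum_b \sum_k c a b k ^+ 2 by apply: sumr_ge0.
have A0 : 0 < \sum_i \sum_j \sum_k c i j k ^+ 2.
  rewrite (bigD1 i) //= ltr_pwDl ?sumr_ge0 //.
  rewrite (bigD1 j) //= ltr_pwDl ?sumr_ge0 //.
  rewrite (bigD1 k) //= ltr_pwDl ?exprn_even_gt0 // sumr_ge0 // => l _.
  exact: sqr_ge0.
lra.
Qed.

End FrameCurvature.

(** * Left-invariant frames *)
Section LieGroupFrame.
Variables (R : realType) (n : nat) (G : lieGroupType R n).
Local Notation E := 'rV[R]_n.
Local Notation VF := (G -> E).
Local Notation one := (1%g : G).
Variables (h : G -> E -> E -> R) (nabla : VF -> VF -> VF).
Hypothesis hR : riemannian_metric h.
Hypothesis hL : left_invariant_metric h.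
Hypothesis LC : levi_civita h nabla.

Lemma metric_left_field p u v : h p (left_field u p) (left_field v p) = h one u v.
Proof. by have := hL p one u v; rewrite mulg1. Qed.

Lemma metric_left_bracket p u v w :
  h p (lie_bracket (left_field u) (left_field v) p) (left_field w p)
  = h one (lie_bracket (left_field u : VF) (left_field v) one) w.
Proof.
have := hL p one (lie_bracket (left_field u : VF) (left_field v) one) w.
by rewrite -lie_bracket_left_invariant mulg1.
Qed.

Variable P : 'I_n -> E.
Hypothesis PP : forall i j, h one (P i) (P j) = (i == j)%:R.

Let F i : VF := left_field (P i).

Let FS i : smooth_field (F i). Proof. exact: smooth_left_field. Qed.

Lemma left_frame_orthonormal p i j : h p (F i p) (F j p) = (i == j)%:R.
Proof. by rewrite metric_left_field. Qed.

Lemma left_field_expand u : left_field u = fun q => \sum_(i < n) h one u (P i) *: F i q.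
Proof.
rewrite {1}(field_expand hR left_frame_orthonormal (left_field u)).
by apply/funext => q; apply: eq_bigr => i _; rewrite metric_left_field.
Qed.

(** The bracket is not tensorial, but a left-invariant field has constant
    coefficients in the frame. *)
Lemma lie_bracket_left_field_eq0 u (Y : VF) : smooth_field Y ->
  (forall i, lie_bracket (F i) Y one = 0) -> lie_bracket (left_field u) Y one = 0.
Proof.
move=> YS FY0; rewrite left_field_expand.
rewrite (operator_frame_sum FS (A := fun f => exists a, f = fun _ => a)
  (T := fun X => lie_bracket X Y one) (c := @^~ one)) //.
- by rewrite big1 // => i _; rewrite FY0 scaler0.
- by move=> f [a ->]; exact: smooth_fun_cst.
- by exists 1.
- move=> f X X' [a ->] XS XS'.
  rewrite (lie_bracket_lincombl LC) //; last exact: smooth_fun_cst.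
  by rewrite /lincomb field_deriv_cst oppr0 scale0r add0r.
- by move=> i; exists (h one u (P i)).
Qed.

Lemma lie_bracket_left_fields_eq0 :
  (forall i j, lie_bracket (F i) (F j) one = 0) ->
  forall u v, lie_bracket (left_field u : VF) (left_field v) one = 0.
Proof.
move=> F0 u v; apply: lie_bracket_left_field_eq0; first exact: smooth_left_field.
move=> i; rewrite (lie_bracket_anti LC) //; last exact: smooth_left_field.
by rewrite /lincomb lie_bracket_left_field_eq0 // scaler0 addr0.
Qed.

End LieGroupFrame.

Theorem theorem3p1 (R : realType) (n : nat) (G : lieGroupType R n)
    (h : G -> 'rV[R]_n -> 'rV[R]_n -> R)
    (nabla : (G -> 'rV[R]_n) -> (G -> 'rV[R]_n) -> (G -> 'rV[R]_n)) :
  connected [set: G] ->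
  (exists a b : G, (a * b)%g <> (b * a)%g) ->
  riemannian_metric h ->
  left_invariant_metric h ->
  cyclic_metric h ->
  levi_civita h nabla ->
  [/\ forall p : G, scalar_curvature h nabla p < 0,
      ~ positive_sectional_curvature h nabla &
      ~ positive_ricci_curvature nabla].
Proof.
move=> Gc [a [b ab]] hR hL hC LC.
have [P PP] := orthonormal_basis
  (metric_linear hR 1%g) (metric_sym hR 1%g) (@metric_pos _ _ _ _ hR 1%g).
pose F i : G -> 'rV[R]_n := left_field (P i).
pose c i j k := h 1%g (lie_bracket (F i) (F j) 1%g) (P k).
have FS i : smooth_field (F i) by exact: smooth_left_field.
have FF := left_frame_orthonormal hL PP.
have cE p i j k : h p (lie_bracket (F i) (F j) p) (F k p) = c i j k.
  exact: metric_left_bracket.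
have cC i j k : c i j k + c j k i + c k i j = 0.
  rewrite -!(cE 1%g); apply: hC; exact: left_field_left_invariant.
have cn0 : exists i j k, c i j k != 0.
  apply: contrapT => c0; apply: ab; apply: commutative_of_brackets0 => //.
  apply: (lie_bracket_left_fields_eq0 hR hL LC PP) => i j.
  rewrite (bracket_frame hR FF cE) big1 // => k _.
  have [->|cijk] := eqVneq (c i j k) 0; first by rewrite scale0r.
  by case: c0; exists i, j, k.
have scal p : scalar_curvature h nabla p < 0 := scalar_curvature_lt0 hR LC FS FF cE cC p cn0.
split=> // [sec|ric].
  by have := scalar_curvature_ge0_of_sectional hR LC FS FF 1%g sec; rewrite leNgt scal.
by have := scalar_curvature_ge0_of_ricci hR LC FS FF 1%g ric; rewrite leNgt scal.
Qed.
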